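(* Consider a robust MDP $(\mathcal{S},\mathcal{A},\boldsymbol{r},\mathcal{U},\boldsymbol{p}_0)$ whose uncertainty set $\mathcal{U}$ is sa-rectangular and compact. Then there exists an average optimal policy that is stationary and deterministic: $$\sup_{\pi\in\Pi_{\sf H}}\ \inf_{\boldsymbol{P}\in\mathcal{U}} R_{\sf avg}(\pi,\boldsymbol{P}) \;=\; \max_{\pi\in\Pi_{\sf SD}}\ \inf_{\boldsymbol{P}\in\mathcal{U}} R_{\sf avg}(\pi,\boldsymbol{P}).$$
   Context: A robust MDP (RMDP) is a tuple $(\mathcal{S},\mathcal{A},\boldsymbol{r},\mathcal{U},\boldsymbol{p}_0)$: $\mathcal{S}$ (states) and $\mathcal{A}$ (actions) are finite nonempty sets, $\boldsymbol{r}\in\mathbb{R}^{\mathcal{S}\times\mathcal{A}\times\mathcal{S}}$ is the reward function, the uncertainty set $\mathcal{U}\subset\Delta(\mathcal{S})^{\mathcal{S}\times\mathcal{A}}$ is a nonempty compact set of transition probabilities $\boldsymbol{P}=(\boldsymbol{p}_{sa})_{s,a}$, and $\boldsymbol{p}_0\in\Delta(\mathcal{S})$ is the initial distribution; $\Delta(\mathcal{S})$ is the simplex of probability distributions on $\mathcal{S}$. The set $\mathcal{U}$ is sa-rectangular if $\mathcal{U}=\prod_{(s,a)\in\mathcal{S}\times\mathcal{A}}\mathcal{U}_{sa}$ with $\mathcal{U}_{sa}\subseteq\Delta(\mathcal{S})$. $\Pi_{\sf H}$ is the set of history-dependent, possibly randomized policies (the distribution of the action $a_t$ may depend on $(s_0,a_0,\dots,s_t)$);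 $\Pi_{\sf SD}\subset\Pi_{\sf H}$ is the (finite) set of stationary deterministic policies, i.e. maps $\mathcal{S}\to\mathcal{A}$. $\mathbb{E}_{\pi,\boldsymbol{P}}$ is expectation with respect to the law of $(s_t,a_t)_{t\ge0}$ induced by $\pi$ and $\boldsymbol{P}$. The average return is $$R_{\sf avg}(\pi,\boldsymbol{P})=\mathbb{E}_{\pi,\boldsymbol{P}}\Big[\limsup_{T\to+\infty}\tfrac{1}{T+1}\sum_{t=0}^{T} r_{s_ta_ts_{t+1}}\ \Big|\ s_0\sim\boldsymbol{p}_0\Big].$$ A policy $\pi\in\Pi_{\sf H}$ is average optimal if it attains the supremum in $\sup_{\pi\in\Pi_{\sf H}}\inf_{\boldsymbol{P}\in\mathcal{U}}R_{\sf avg}(\pi,\boldsymbol{P})$. *)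

(* Defs.v *)
From HB Require Import structures.
From mathcomp Require Import all_boot all_order all_algebra.
From mathcomp Require Import all_classical all_reals all_analysis.
Import Order.TTheory GRing.Theory Num.Theory.
Import numFieldNormedType.Exports.

Set Implicit Arguments.
Unset Strict Implicit.
Unset Printing Implicit Defensive.

Local Open Scope classical_set_scope.
Local Open Scope ring_scope.

(* Finite nonempty types. The chosen point is the form in which the library's
   measurable types ask for nonemptiness; which point is chosen plays no role. *)
#[short(type="pointedFinType")]
HB.structure Definition PointedFinite := {T of Pointed T & Finite T}.

HB.instance Definition _ (S A : pointedFinType) := Finite.on (S * A)%type.

Definition simplex (R : realType) (T : finType) : set (T -> R) :=
  [set p | (forall x, 0 <= p x) /\ \sum_x p x = 1].
Arguments simplex R T : clear implicits.

Section trajectories.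
Context (T : pointedFinType).

Definition cylinder (w : nat -> T) (n : nat) : set (nat -> T) :=
  [set w' | forall t, (t < n)%N -> w' t = w t].

Definition cylinders : set (set (nat -> T)) :=
  [set C | exists w n, C = cylinder w n].

Definition trajectory : measurableType cylinders.-sigma :=
  g_sigma_algebraType cylinders.

End trajectories.

(* [k h] is the distribution of the next coordinate given the finite past [h],
   listed in chronological order. The law exists and is unique as soon as
   every [k h] is a distribution: see [trajectory_lawP] and
   [is_trajectory_law_unique] below. *)
Definition is_trajectory_law (R : realType) (T : pointedFinType)
    (k : seq T -> T -> R) : set (probability (trajectory T) R) :=
  [set mu | forall w n,
    mu (cylinder w n) = (\prod_(t < n) k (mkseq w t) (w t))%:E].

Definition trajectory_law (R : realType) (T : pointedFinType)
    (k : seq T -> T -> R) : probability (trajectory T) R :=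
  get (is_trajectory_law k).

Section unique.
Context (R : realType) (T : pointedFinType) (k : seq T -> T -> R).

Lemma is_trajectory_law_unique (mu nu : probability (trajectory T) R) :
  is_trajectory_law k mu -> is_trajectory_law k nu ->
  forall B, measurable B -> mu B = nu B.
Proof.
move=> hmu hnu B mB.
pose G : set (set (trajectory T)) := @cylinders T `|` [set set0].
apply: (measure_unique G (fun=> setT)) => //.
- rewrite /measurable /=; apply/seteqP; split.
    apply: smallest_sub; first exact: smallest_sigma_algebra.
    by move=> C hC; apply: sub_sigma_algebra; left.
  apply: smallest_sub; first exact: smallest_sigma_algebra.
  by move=> C [hC|->]; [exact: sub_sigma_algebra|exact: sigma_algebra0].
- move=> C D [[w [n ->]]|->]; last by move=> _; rewrite set0I; right.
  move=> [[w' [n' ->]]|->]; last by rewrite setI0; right.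
  have [[v [hv hv']]|no] :=
      pselect ((cylinder w n `&` cylinder w' n') !=set0); last first.
    right=> /=; apply/seteqP; split=> [x hx|x //]; case: no; exists x; exact: hx.
  left; exists v, (maxn n n'); apply/seteqP; split=> [x [h1 h2] t|x h].
    by rewrite leq_max => /orP[] h; [rewrite h1 ?hv|rewrite h2 ?hv'].
  split=> t ht; (rewrite h; last by rewrite leq_max ht ?orbT).
    exact: hv.
  exact: hv'.
- move=> _; left; exists (fun=> point), 0%N; exact/seteqP.
- by apply/seteqP; split=> // x _; exists 0%N.
- by move=> C [[w [n ->]]|->]; rewrite ?measure0 //; exact: etrans (hmu w n) (esym (hnu w n)).
- by move=> _; apply: le_lt_trans (probability_le1 mu measurableT) (ltry _).
Qed.

End unique.

(* The law is realised as the image of the Lebesgue measure on [0, 1[ under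
   successive subdivisions of the interval. *)
Section existence.
Context (R : realType) (T : pointedFinType) (k : seq T -> T -> R).
Hypothesis kP : forall h, simplex R T (k h).

Let k0 h a : 0 <= k h a. Proof. by case: (kP h). Qed.

Let cum (h : seq T) (m : nat) : R := \sum_(b | (enum_rank b < m)%N) k h b.

Let cum0 h : cum h 0 = 0. Proof. by rewrite /cum big_pred0. Qed.

Let cumT h : cum h #|T| = 1.
Proof.
by case: (kP h) => _ <-; rewrite /cum; apply: eq_bigl => b; rewrite ltn_ord.
Qed.

Let cumS h a : cum h (enum_rank a).+1 = cum h (enum_rank a) + k h a.
Proof.
rewrite /cum (bigD1 a) /= ?ltnS // addrC; congr (_ + _).
apply: eq_bigl => b; rewrite ltnS (ltn_neqAle (enum_rank b)) andbC.
by congr (_ && _); rewrite -(inj_eq enum_rank_inj).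
Qed.

Let cum_le h m n : (m <= n)%N -> cum h m <= cum h n.
Proof.
move=> mn; rewrite /cum big_mkcond [leRHS]big_mkcond; apply: ler_sum => b _.
case: ifP => [/leq_trans -> //|_]; by case: ifP.
Qed.

(* In the rest of this section pasts are listed backwards. *)
Let wt : seq T -> R :=
  fix F r := if r is a :: r' then F r' * k (rev r') a else 1.

Let lo : seq T -> R := fix F r :=
  if r is a :: r' then F r' + wt r' * cum (rev r') (enum_rank a) else 0.

Let inI (u : R) r := lo r <= u < lo r + wt r.

Let next u r : T := odflt point [pick a | inI u (a :: r)].

Let past u : nat -> seq T :=
  fix F n := if n is n'.+1 then next u (F n') :: F n' else [::].

Let wt_ge0 r : 0 <= wt r.
Proof. by elim: r => //= a r IH; rewrite mulr_ge0. Qed.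

Let inI_cons u a r : inI u (a :: r) -> inI u r.
Proof.
move=> /andP[/= h1 h2]; apply/andP; split.
  by apply: le_trans h1; rewrite lerDl mulr_ge0 // sumr_ge0.
apply: lt_le_trans h2 _; rewrite -addrA lerD2l -mulrDr -cumS ler_piMr //.
by rewrite -(cumT (rev r)) cum_le.
Qed.

Let inI_uniq u a b r : inI u (a :: r) -> inI u (b :: r) -> a = b.
Proof.
wlog ab : a b / (enum_rank a <= enum_rank b)%N.
  move=> H; case: (leqP (enum_rank a) (enum_rank b)); first exact: H.
  by move=> /ltnW ba h1 h2; apply/esym/H.
move=> /andP[_ /= h1] /andP[/= h2 _]; apply/eqP/negPn/negP => neq.
have {}ab : (enum_rank a < enum_rank b)%N.
  by rewrite ltn_neqAle ab andbT (inj_eq val_inj) (inj_eq enum_rank_inj).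
have := le_lt_trans h2 h1.
rewrite -addrA ltrD2l -mulrDr -cumS => /lt_geF/negP; apply.
by rewrite ler_wpM2l // cum_le.
Qed.

Let inI_ex u r : inI u r -> exists a, inI u (a :: r).
Proof.
move=> /andP[h1 h2].
have ex : exists m, u < lo r + wt r * cum (rev r) m.
  by exists #|T|; rewrite cumT mulr1.
case: (ex_minnP ex) => -[|m] hm min; first by move: hm; rewrite cum0 mulr0 addr0 ltNge h1.
have mT : (m < #|T|)%N by apply: min; rewrite cumT mulr1.
exists (enum_val (Ordinal mT)); apply/andP => /=.
split; last by rewrite -addrA -mulrDr -cumS enum_valK.
rewrite enum_valK /= leNgt; apply/negP => /min; by rewrite ltnn.
Qed.

Let nextP u r : inI u r -> inI u (next u r :: r).
Proof.
move=> /inI_ex[a ha]; rewrite /next; case: pickP => [//|/(_ a)].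
by rewrite ha.
Qed.

Let pastP u n : 0 <= u < 1 -> inI u (past u n).
Proof.
by move=> hu; elim: n => [|n /nextP//]; rewrite /inI /= add0r.
Qed.

Let past_uniq u r : 0 <= u < 1 -> inI u r -> past u (size r) = r.
Proof.
move=> hu; elim: r => // a r IH h /=.
rewrite (IH (inI_cons h)); congr (_ :: _).
by apply: inI_uniq (h); exact/nextP/(inI_cons h).
Qed.

Let path (u : R) : trajectory T :=
  fun t => if 0 <= u < 1 then next u (past u t) else point.

Let past_path u n : 0 <= u < 1 -> past u n = rev (mkseq (path u) n).
Proof.
move=> hu; elim: n => // n IH; rewrite mkseqS rev_rcons -IH /=.
by rewrite /path hu.
Qed.

Let rev_mkseqS (w : nat -> T) n :
  rev (mkseq w n.+1) = w n :: rev (mkseq w n).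
Proof. by rewrite mkseqS rev_rcons. Qed.

Let wtE (w : nat -> T) n :
  wt (rev (mkseq w n)) = \prod_(t < n) k (mkseq w t) (w t).
Proof.
elim: n => [|n IH]; first by rewrite big_ord0.
by rewrite rev_mkseqS big_ord_recr /= IH revK.
Qed.

Let eq_rev_mkseq (w w' : nat -> T) n :
  cylinder w n w' <-> rev (mkseq w' n) = rev (mkseq w n).
Proof.
elim: n => [|n IH]; first by split=> // _ t.
rewrite !rev_mkseqS; split=> [h|[e /IH h] t].
  by rewrite (h n) // IH.1 // => t tn; apply: h; rewrite ltnS ltnW.
by rewrite ltnS leq_eqVlt => /orP[/eqP ->//|]; exact: h.
Qed.

Let lo_ge0 r : 0 <= lo r.
Proof. by elim: r => //= a r IH; rewrite addr_ge0 // mulr_ge0 // sumr_ge0. Qed.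

Let hi_le1 r : lo r + wt r <= 1.
Proof.
elim: r => [|a r IH] /=; first by rewrite add0r.
apply: le_trans IH; rewrite -addrA lerD2l -mulrDr -cumS ler_piMr //.
by rewrite -(cumT (rev r)) cum_le.
Qed.

Let unit_itv : set R := `[0, 1[.

Let path_cylinder w n : (path @^-1` cylinder w n) `&` unit_itv =
  `[lo (rev (mkseq w n)), lo (rev (mkseq w n)) + wt (rev (mkseq w n))[%classic.
Proof.
apply/seteqP; split=> u; rewrite /unit_itv /= !in_itv /=.
  by move=> [/eq_rev_mkseq <- hu]; rewrite -past_path //; exact: pastP.
move=> hu; have hu1 : 0 <= u < 1.
  case/andP: hu => h1 h2; rewrite (le_trans (lo_ge0 _) h1) /=.
  by rewrite (lt_le_trans h2) // hi_le1.
split=> //; apply/eq_rev_mkseq; rewrite -past_path //.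
by have := past_uniq hu1 hu; rewrite size_rev size_mkseq.
Qed.

Let measurable_path : measurable_fun setT path.
Proof.
apply: (@measurability _ _ _ (trajectory T) setT path (@cylinders T)) => // _ [_ [w [n ->]] <-].
rewrite setTI.
have mI : measurable unit_itv by exact: measurable_itv.
rewrite -(setIT (path @^-1` _)) -(setUv unit_itv) setIUr.
apply: measurableU; first by rewrite path_cylinder; exact: measurable_itv.
have [h|h] := pselect (cylinder w n (fun=> point)).
  suff -> : path @^-1` cylinder w n `&` ~` unit_itv = ~` unit_itv.
    exact: measurableC.
  apply/seteqP; split=> u; first by case.
  move=> hu; split=> // t tn.
  by rewrite -(h t tn) /path; case: ifP.
suff -> : path @^-1` cylinder w n `&` ~` unit_itv = set0 by exact: measurable0.
apply/seteqP; split=> // u [hc hu]; apply: h => t tn.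
by rewrite -(hc t tn) /path; case: ifP.
Qed.

Let lebesgue01 (B : set R) : measurable B ->
  uniform_prob (@ltr01 R) B = lebesgue_measure (B `&` unit_itv).
Proof.
move=> mB; have mI : measurable unit_itv by exact: measurable_itv.
rewrite /uniform_prob integral_uniform_pdf.
rewrite (eq_integral (fun=> 1%E)) => [|x]; last first.
  rewrite inE => -[_] /=; rewrite in_itv /= /uniform_pdf => ->.
  by rewrite subr0 invr1.
rewrite integral_cst ?mul1e; last by apply: measurableI => //; exact: measurable_itv.
rewrite -(@setUitv1 _ _ (BLeft 0) 1 true) ?bnd_simp // setIUr.
rewrite measureU0 //; [exact: measurableI|exact: measurableI|].
apply: measure_negligible; first exact: measurableI.
by exists [set 1%R]; split=> //; exact: lebesgue_measure_set1.
Qed.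

Lemma is_trajectory_law_nonempty : is_trajectory_law k !=set0.
Proof.
have mX : measurable_fun (setT : set (measurableTypeR R)) path.
  exact: measurable_path.
pose X : {mfun (measurableTypeR R) >-> trajectory T} :=
  HB.pack path (isMeasurableFun.Build _ _ (measurableTypeR R) (trajectory T) path mX).
exists (distribution (uniform_prob (@ltr01 R)) X) => w n.
have mc : measurable (cylinder w n : set (trajectory T)).
  by apply: sub_sigma_algebra; exists w, n.
have mp : measurable (path @^-1` cylinder w n).
  by rewrite -[X in measurable X]setTI; exact: measurable_path.
apply: etrans (lebesgue01 mp) _.
rewrite path_cylinder lebesgue_measure_itv /= lte_fin ltrDl -wtE.
case: ltP => [_|]; first by rewrite -EFinB addrC addKr.
by move=> h; congr EFin; apply/le_anti/andP.
Qed.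

Lemma trajectory_lawP : is_trajectory_law k (trajectory_law k).
Proof.
by case: is_trajectory_law_nonempty => mu h; exact: getI h.
Qed.

End existence.

Record rmdp (R : realType) (S A : pointedFinType) := RMDP {
  reward : S -> A -> S -> R;
  uncertainty : set {ptws S * A -> {ptws S -> R}};
  init : S -> R;
  uncertainty_simplex : forall P, uncertainty P -> forall sa, simplex R S (P sa);
  uncertainty_nonempty : uncertainty !=set0;
  uncertainty_compact : compact uncertainty;
  init_simplex : simplex R S init
}.

Definition sa_rectangular (R : realType) (S A : pointedFinType)
    (U : set {ptws S * A -> {ptws S -> R}}) : Prop :=
  exists2 Usa : S * A -> set (S -> R),
    (forall sa, Usa sa `<=` simplex R S) &
    U = [set P | forall sa, Usa sa (P sa)].

Section policies.
Context (R : realType) (S A : pointedFinType).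

(* [pi h s] is the distribution of the action chosen in state [s] after the
   past state-action pairs [h], listed in chronological order. *)
Definition policy := seq (S * A) -> S -> A -> R.

Definition history_dependent : set policy :=
  [set pi | forall h s, simplex R A (pi h s)].

Definition stationary_deterministic (f : S -> A) : policy :=
  fun _ s a => (a == f s)%:R.

Lemma stationary_deterministic_history_dependent f :
  history_dependent (stationary_deterministic f).
Proof.
move=> h s; split=> [a|]; first exact: ler0n.
by rewrite (bigD1 (f s)) //= /stationary_deterministic eqxx big1 ?addr0 // => a /negPf ->.
Qed.

Definition next_pair (p0 : S -> R) (P : S * A -> S -> R) (pi : policy)
    (h : seq (S * A)) (x : S * A) : R :=
  (if h is y :: h' then P (last y h') x.1 else p0 x.1) * pi h x.1 x.2.

Lemma next_pair_simplex p0 P pi : simplex R S p0 ->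
  (forall sa, simplex R S (P sa)) -> history_dependent pi ->
  forall h, simplex R (S * A)%type (next_pair p0 P pi h).
Proof.
move=> [p00 p01] PP piP h; split=> [[s a]|].
  rewrite mulr_ge0 //=; last by case: (piP h s).
  by case: h => [|y h]; [exact: p00|case: (PP (last y h))].
rewrite -(pair_bigA _ (fun s a => next_pair p0 P pi h (s, a))).
rewrite /next_pair /=.
under eq_bigr do rewrite -mulr_sumr (piP h _).2 mulr1.
by case: h => [|y h]; [exact: p01|case: (PP (last y h))].
Qed.

End policies.

Section average_return.
Context (R : realType) (S A : pointedFinType) (M : rmdp R S A).

Definition law (pi : policy R S A) (P : S * A -> S -> R) :
    probability (trajectory (S * A)%type) R :=
  trajectory_law (next_pair (init M) P pi).

Lemma law_cylinder pi P : history_dependent pi -> uncertainty M P ->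
  forall w n, law pi P (cylinder w n) =
    (\prod_(t < n) next_pair (init M) P pi (mkseq w t) (w t))%:E.
Proof.
move=> piH UP; apply: trajectory_lawP; apply: next_pair_simplex => //.
  exact: init_simplex.
exact: uncertainty_simplex UP.
Qed.

Definition mean_reward (w : nat -> S * A) (n : nat) : R :=
  n.+1%:R^-1 * \sum_(t < n.+1) reward M (w t).1 (w t).2 (w t.+1).1.

Local Open Scope ereal_scope.

(* As rewards are bounded, the real-valued [limn_sup] is the genuine limit
   superior, and the extended real values below are finite. *)
Definition Ravg (pi : policy R S A) (P : S * A -> S -> R) : \bar R :=
  'E_(law pi P)[fun w => limn_sup (mean_reward w)].

Definition worst_Ravg (pi : policy R S A) : \bar R :=
  ereal_inf [set Ravg pi P | P in uncertainty M].

Definition optimal_Ravg : \bar R :=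
  ereal_sup [set worst_Ravg pi | pi in @history_dependent R S A].

Definition average_optimal (pi : policy R S A) : Prop :=
  history_dependent pi /\ worst_Ravg pi = optimal_Ravg.

End average_return.

(* Main.v *)
(* Weak duality reduces the theorem to a finite game. If every stationary
   deterministic [f] had worst-case return below the optimal value [V], pick a
   model [P_f] witnessing it; by rectangularity all mixtures of the [P_f] across
   state-action pairs are models, so they form a finite game with perfect
   information. In that game, discounted stationary saddle points exist for
   every discount factor, one pair [(f, tau)] recurs as the factor tends to 1, and the
   expansion [v = g / x + h + O(x)] of its value ([x] is one minus the factor)
   yields [g] and [h] with
     [P_tau g <= g] and [P_tau (r + h) <= g + h] at all state-action pairs,
     [g <= P_b g] and [g + h <= P_b (r + h)] at [(s, f s)] for all moves [b].
   The first line bounds by [p0 . g] the return against [P_tau] of any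
   history-dependent policy: the reward sum is at most a martingale with bounded
   increments, negligible by its fourth moment, plus the sum of the [g s_t], and
   [g s_t] almost surely changes only finitely often. The second line and the
   reverse Fatou lemma bound by [p0 . g] from below the return of [f] against
   every mixture. Hence [V <= p0 . g <= Ravg f P_f < V], a contradiction. *)
From HB Require Import structures.
Require Import Defs.
From mathcomp Require Import all_boot all_order all_algebra.
From mathcomp Require Import all_classical all_reals all_analysis.
From mathcomp Require Import measurable_realfun ring lra.
Import Order.TTheory GRing.Theory Num.Theory.
Import numFieldNormedType.Exports.

Set Implicit Arguments.
Unset Strict Implicit.
Unset Printing Implicit Defensive.

Local Open Scope classical_set_scope.
Local Open Scope ring_scope.

(** * Finite perfect-information games with average payoff *)

Section averaging.
Context (R : realType) (S : finType).
Implicit Types (p u v : S -> R).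

Definition avg p u : R := \sum_s p s * u s.

Lemma eq_avg p u v : u =1 v -> avg p u = avg p v.
Proof. by move=> uv; apply: eq_bigr => s _; rewrite uv. Qed.

Lemma avgD p u v : avg p (fun s => u s + v s) = avg p u + avg p v.
Proof. by rewrite /avg -big_split; apply: eq_bigr => s _; rewrite mulrDr. Qed.

Lemma avgZ p c u : avg p (fun s => c * u s) = c * avg p u.
Proof. by rewrite /avg mulr_sumr; apply: eq_bigr => s _; rewrite mulrCA. Qed.

Lemma avgN p u : avg p (fun s => - u s) = - avg p u.
Proof. by rewrite /avg -sumrN; apply: eq_bigr => s _; rewrite mulrN. Qed.

Lemma avg_cst p c : simplex R S p -> avg p (fun=> c) = c.
Proof. by move=> [_ p1]; rewrite /avg -mulr_suml p1 mul1r. Qed.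

Lemma le_avg p u v : simplex R S p -> (forall s, u s <= v s) ->
  avg p u <= avg p v.
Proof. by move=> [p0 _] uv; apply: ler_sum => s _; exact: ler_wpM2l. Qed.

Lemma avg_le p u c : simplex R S p -> (forall s, u s <= c) -> avg p u <= c.
Proof. by move=> pP uc; rewrite -[leRHS](avg_cst c pP); exact: le_avg. Qed.

Lemma norm_avg_le p u c : simplex R S p -> (forall s, `|u s| <= c) ->
  `|avg p u| <= c.
Proof.
move=> pP uc; rewrite ler_norml -{1}(avg_cst c pP) -avgN.
by apply/andP; split; [apply: le_avg|apply: avg_le] => // s;
   have := uc s; rewrite ler_norml => /andP[].
Qed.

End averaging.

Lemma fin_norm_bound (R : realType) (I : finType) (u : I -> R) :
  exists2 C, 0 <= C & forall i, `|u i| <= C.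
Proof.
exists (\sum_i `|u i|) => [|i]; first exact: sumr_ge0.
by rewrite (bigD1 i) //= lerDl sumr_ge0.
Qed.

(** * Poisson equation and discounted values of a finite Markov chain *)

Section markov_chain.
Context (R : realType) (S : finType) (p : S -> S -> R).
Hypothesis pP : forall s, simplex R S (p s).

Let V : vectType R := {ffun S -> R^o}.

Let dif (u : V) : V := [ffun s => u s - avg (p s) u].

Let dif_linear : linear dif.
Proof.
move=> c u v; apply/ffunP => s; rewrite !ffunE.
have -> : avg (p s) (c *: u + v) = avg (p s) (fun s => c * u s + v s).
  by apply: eq_avg => s'; rewrite !ffunE.
by rewrite avgD avgZ; rewrite /GRing.scale /=; lra.
Qed.

HB.instance Definition _ := GRing.isLinear.Build R V V _ dif dif_linear.

(* If [y = u - p u] is fixed by [p], the [n]th iterate of [u] under [p] is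
   [u - n y], which stays bounded only if [y = 0]. *)
Let dif_dif0 u : dif (dif u) = 0 -> dif u = 0.
Proof.
set y := dif u => hy; apply/ffunP => s; rewrite [RHS]ffunE.
have py s' : avg (p s') y = y s'.
  by move/ffunP: hy => /(_ s'); rewrite !ffunE => /eqP; rewrite subr_eq0 => /eqP.
have pu s' : avg (p s') u = u s' - y s' by rewrite /y ffunE; lra.
have [C C0 hC] := fin_norm_bound u.
have hn n s' : `|u s' - n%:R * y s'| <= C.
  elim: n s' => [|n IH] s'; first by rewrite mul0r subr0.
  have -> : u s' - n.+1%:R * y s' = avg (p s') (fun t => u t - n%:R * y t).
    rewrite avgD avgN avgZ py pu -natr1; lra.
  exact: norm_avg_le.
apply/eqP; rewrite -normr_le0 leNgt; apply/negP => y0.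
have := archi_boundP (_ : 0 <= 2 * C / `|y s|).
rewrite divr_ge0 ?mulr_ge0 // => /(_ isT).
set n := Num.bound _; rewrite ltr_pdivrMr // ltNge => /negP; apply.
rewrite -[n%:R]normr_nat -normrM.
have -> : n%:R * y s = u s - (u s - n%:R * y s) by lra.
by apply: le_trans (ler_normB _ _) _; have := hn n s; have := hC s; lra.
Qed.

(** By [dif_dif0] the composite of [dif] with itself has the kernel of [dif], so by rank-nullity its
    image has the same dimension; being contained in the image of [dif], it equals it. *)
Let dif_range (u : V) : exists h : V, dif (dif h) = dif u.
Proof.
pose D : 'End(V) := linfun dif.
have DE w : D w = dif w by rewrite lfunE.
have kE : lker (D \o D)%VF = lker D.
  apply/vspaceP => w; rewrite !memv_ker comp_lfunE !DE.
  by apply/eqP/eqP => [/dif_dif0//|->]; rewrite linear0.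
have : (limg (D \o D)%VF == limg D)%VS.
  rewrite eqEdim limg_comp limgS ?subvf //=.
  rewrite -limg_comp.
  have := limg_ker_dim (D \o D)%VF fullv; have := limg_ker_dim D fullv.
  by rewrite !capfv kE => <- /addnI ->.
move=> /eqP e; have : D u \in limg D by rewrite memv_img ?memvf.
rewrite -e => /memv_imgP[h _]; rewrite comp_lfunE !DE => ->; by exists h.
Qed.

(** The space is the sum of the kernel and the range of [dif]. Splitting [r] yields the gain [g] and
    some [h1]; splitting [h1] in turn puts the bias [h] in the range of [dif], and the resulting
    [h'] controls the next order in [discounted_value_expansion]. *)
Lemma poisson_equation (r : S -> R) : exists g h : S -> R,
  [/\ forall s, avg (p s) g = g s,
      forall s, r s = g s + h s - avg (p s) h &
      exists h', forall s, h s = h' s - avg (p s) h'].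
Proof.
have dec (w : V) : exists g h : V, w = g + dif h /\ dif g = 0.
  have [h eh] := dif_range w; exists (w - dif h), h.
  by rewrite subrK linearB /= eh subrr.
have [g [h1 [er eg]]] := dec (finfun r).
have [g1 [h' [eh1 eg1]]] := dec h1.
have fixg (w : V) : dif w = 0 -> forall s, avg (p s) w = w s.
  by move=> /ffunP + s => /(_ s); rewrite !ffunE => /eqP; rewrite subr_eq0 => /eqP.
exists g, (dif h'); split=> [s|s|]; first exact: fixg.
  have := congr1 (fun f : V => f s) er; rewrite eh1 linearD /= eg1 add0r !ffunE.
  by move=> ->; lra.
by exists h' => s; rewrite ffunE.
Qed.

(* Here [x] is one minus the discount factor. *)
Lemma discounted_value_expansion (r : S -> R) : exists g h : S -> R,
  exists2 C, 0 <= C & forall (x : R) v, 0 < x <= 1 ->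
    (forall s, v s = r s + (1 - x) * avg (p s) v) ->
    forall s, `|v s - g s / x - h s| <= C * x.
Proof.
have [g [h [pg rE [h' hE]]]] := poisson_equation r.
have [C C0 hC] := fin_norm_bound h'.
exists g, h, (2 * C) => [|x v /andP[x0 x1] vE s]; first by rewrite mulr_ge0.
have phC s' : `|avg (p s') h'| <= C by exact: norm_avg_le.
have pphC s' : `|avg (p s') (fun t => avg (p t) h')| <= C by exact: norm_avg_le.
(* Removing the first-order term [- x * avg (p t) h'] as well leaves a remainder that solves the
   discounted equation with a source of order [x ^+ 2]. Discounting amplifies a source by at most
   [1 / x], so [e] is of order [x]. *)
pose e t := v t - g t / x - h t + x * avg (p t) h'.
have eE t : e t = (1 - x) * avg (p t) e +
    x ^+ 2 * avg (p t) (fun t' => avg (p t') h').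
  have -> : avg (p t) e = avg (p t) v - avg (p t) g / x - avg (p t) h +
      x * avg (p t) (fun t => avg (p t) h').
    rewrite /e !avgD !avgN avgZ; congr (_ - _ - _ + _).
    by rewrite [RHS]mulrC -avgZ; apply: eq_avg => ?; rewrite mulrC.
  have -> : avg (p t) h = avg (p t) h' - avg (p t) (fun t => avg (p t) h').
    by rewrite -avgN -avgD; exact: eq_avg.
  rewrite /e vE rE pg hE.
  have -> : avg (p t) h = avg (p t) h' - avg (p t) (fun t => avg (p t) h').
    by rewrite -avgN -avgD; exact: eq_avg.
  by field; rewrite gt_eqF.
have eb t : `|e t| <= C * x.
  pose m := [arg max_(i > s) `|e i|]%O.
  have mP i : `|e i| <= `|e m| by rewrite /m; case: arg_maxP => // j _; exact.
  apply: le_trans (mP t) _.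
  have h1 : `|e m| <= (1 - x) * `|e m| + x ^+ 2 * C.
    rewrite {1}eE; apply: le_trans (ler_normD _ _) _; apply: lerD.
      rewrite normrM ger0_norm ?subr_ge0 // ler_wpM2l ?subr_ge0 //.
      exact: norm_avg_le.
    by rewrite normrM ger0_norm ?sqr_ge0 // ler_wpM2l ?sqr_ge0.
  rewrite -(ler_pM2l x0); lra.
have -> : v s - g s / x - h s = e s - x * avg (p s) h' by rewrite /e; lra.
apply: le_trans (ler_normB _ _) _.
rewrite normrM (gtr0_norm x0).
have := eb s; have : x * `|avg (p s) h'| <= x * C by rewrite ler_pM2l.
lra.
Qed.

End markov_chain.

(** Tarski's argument: the pointwise supremum [v] of the subsolutions bounded by [c] is again a
    subsolution, and so is [T v], whence [T v <= v]. The constant [- c] is a subsolution to start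
    from. *)
Lemma monotone_fixpoint (R : realType) (S : finType)
    (T : (S -> R) -> S -> R) (c : R) : 0 <= c ->
  (forall u v, (forall s, u s <= v s) -> forall s, T u s <= T v s) ->
  (forall s, T (fun=> c) s <= c) -> (forall s, - c <= T (fun=> - c) s) ->
  exists v, forall s, v s = T v s.
Proof.
move=> c0 mono Tc Tnc.
pose sub u := (forall s, u s <= c) /\ (forall s, u s <= T u s).
pose E s : set R := [set u s | u in sub].
have Esup s : has_sup (E s).
  split; first by exists (- c), (fun=> - c) => //; split=> // ?; lra.
  by exists c => _ [u [uc _] <-].
pose v s := sup (E s).
have subv u s : sub u -> u s <= v s.
  by move=> su; apply: ub_le_sup; [case: (Esup s)|exists u].
have vc s : v s <= c.
  by apply: ge_sup; [case: (Esup s)|move=> _ [u [uc _] <-]].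
have vT s : v s <= T v s.
  apply: ge_sup; first by case: (Esup s).
  move=> _ [u su <-]; apply: le_trans (su.2 s) _.
  by apply: mono => t; exact: subv.
exists v => s; apply/le_anti; rewrite vT /=.
by apply: subv; split=> t; [apply: le_trans (Tc t); exact: mono|exact: mono].
Qed.

Lemma pigeonhole_infinite (F : finType) (c : nat -> F) :
  exists x, forall N, exists2 n, (N <= n)%N & c n = x.
Proof.
apply: contrapT => no.
have {}no x : exists N, forall n, (N <= n)%N -> c n <> x.
  apply: contrapT => h; apply: no; exists x => N; apply: contrapT => h'.
  by apply: h; exists N => n Nn cn; apply: h'; exists n.
have [N hN] := choice no.
apply: (hN (c (\max_x N x)) (\max_x N x)) => //; exact: leq_bigmax.
Qed.

(** For large [n] the linear term dominates, and the constant term does so when [a = 0]; the bound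
    is thus read off order by order. *)
Lemma expansion_ge0 (R : realType) (a b C : R) : 0 <= C ->
  (forall N, exists2 n, (N <= n)%N & 0 <= a * n.+1%:R + b + C / n.+1%:R) ->
  0 <= a /\ (a = 0 -> 0 <= b).
Proof.
move=> C0 h; have step n : C / n.+1%:R <= C.
  by rewrite ler_pdivrMr // ler_peMr // ler1n.
split.
  rewrite leNgt; apply/negP => a0.
  have := archi_boundP (_ : 0 <= (`|b| + C) / - a).
  rewrite divr_ge0 ?addr_ge0 // ?oppr_ge0 ?ltW // => /(_ isT).
  set N := Num.bound _; rewrite ltr_pdivrMr ?oppr_gt0 // => hN.
  have [n Nn] := h N; have := step n; have := ler_norm b.
  have : a * n.+1%:R <= a * N%:R by rewrite ler_nM2l // ler_nat ltnW.
  move: hN; set C' := C / _; set an := a * _; rewrite mulrC mulNr => *; lra.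
move=> a0; rewrite leNgt; apply/negP => b0.
have := archi_boundP (_ : 0 <= C / - b).
rewrite divr_ge0 // ?oppr_ge0 1?ltW // => /(_ isT).
set N := Num.bound _; rewrite ltr_pdivrMr ?oppr_gt0 // => hN.
have [n Nn] := h N; rewrite a0 mul0r add0r.
have : C / n.+1%:R < - b.
  rewrite ltr_pdivrMr //; apply: lt_le_trans hN _.
  by rewrite mulrC ler_wpM2l ?oppr_ge0 ?ltW // ltr_nat ltnS.
set C' := C / _ => *; lra.
Qed.

(** Inserting the expansion of [v n] gives an inequality in powers of [n.+1]. Its linear coefficient
    is [g s - avg p g]; the discount factor acting on the linear term contributes the extra
    [avg p g] to the constant coefficient. *)
Lemma discounted_inequality_limit (R : realType) (S : finType)
    (p rho g h : S -> R) (v : nat -> S -> R) (C : R) s : 0 <= C ->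
  simplex R S p ->
  (forall N, exists2 n, (N <= n)%N &
     (forall t, `|v n t - g t * n.+1%:R - h t| <= C / n.+1%:R) /\
     avg p (fun t => rho t + (1 - n.+1%:R^-1) * v n t) <= v n s) ->
  avg p g <= g s /\
  (avg p g = g s -> avg p (fun t => rho t + h t) <= g s + h s).
Proof.
move=> C0 pP hyp; have [H H0 hH] := fin_norm_bound h.
suff [] : 0 <= g s - avg p g /\
    (g s - avg p g = 0 -> 0 <= h s - avg p rho + avg p g - avg p h).
  rewrite subr_ge0 => ? hb; split=> // e; rewrite avgD.
  by have := hb; rewrite e subrr => /(_ erefl); lra.
apply: (@expansion_ge0 _ _ _ (H + 2 * C)); first by rewrite addr_ge0 ?mulr_ge0.
move=> N; have [n Nn [hv hle]] := hyp N; exists n => //.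
set x := n.+1%:R^-1 in hle hv *; set y := n.+1%:R in hv *.
have y0 : 0 < y by rewrite ltr0n.
have xy : x * y = 1 by rewrite mulVf // gt_eqF.
have x0 : 0 < x by rewrite invr_gt0.
have x1 : x <= 1 by rewrite invf_le1 // ler1n.
pose e t := v n t - g t * y - h t.
have : avg p (fun t => rho t + (1 - x) * v n t) =
    avg p rho + (1 - x) * (avg p g * y + avg p h + avg p e).
  rewrite avgD avgZ; congr (_ + _ * _).
  by rewrite mulrC -avgZ -!avgD; apply: eq_avg => t; rewrite /e; lra.
have peC : `|avg p e| <= C * x by exact: norm_avg_le.
have es := hv s; rewrite -/(e s) in es.
have vE : v n s = g s * y + h s + e s by rewrite /e; lra.
have phH : `|avg p h| <= H by exact: norm_avg_le.
have xph : x * avg p h <= x * H.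
  by rewrite ler_pM2l //; exact: le_trans (ler_norm _) phH.
have pe2 : - (1 - x) * avg p e <= C * x.
  rewrite mulNr -mulrN; apply: le_trans (ler_norm _) _.
  rewrite normrM normrN ger0_norm ?subr_ge0 //.
  apply: le_trans peC; rewrite ler_piMl // gerBl; exact: ltW.
move=> E; move: hle; rewrite E vE => hle.
have : e s <= C * x by apply: le_trans (ler_norm _) es.
move: hle.
have -> : (1 - x) * (avg p g * y + avg p h + avg p e) =
  avg p g * y - avg p g * (x * y) + avg p h - x * avg p h + (1 - x) * avg p e
  by lra.
rewrite xy; lra.
Qed.

(** Where [a i] is positive, any [k] above [- b i / a i] works, and finiteness of [I] gives a common
    bound. This merges first- and second-order inequalities into one without an equality
    condition. *)
Lemma uniform_multiplier (R : realType) (I : finType) (a b : I -> R) :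
  (forall i, 0 <= a i /\ (a i = 0 -> 0 <= b i)) ->
  exists2 K, 0 <= K & forall k, K <= k -> forall i, 0 <= k * a i + b i.
Proof.
move=> h; have [K K0 hK] := fin_norm_bound (fun i => b i / a i).
exists K => // k Kk i; have [a0 b0] := h i.
have [ai|ai] := eqVneq (a i) 0; first by rewrite ai mulr0 add0r b0.
have {}a0 : 0 < a i by rewrite lt_def ai.
have := hK i; rewrite normrM normfV (gtr0_norm a0) ler_pdivrMr // => hb.
have : K * a i <= k * a i by rewrite ler_pM2r.
by have := ler_norm (- b i); rewrite normrN; lra.
Qed.

(** * Finite games in which the minimiser replies to the state and the action *)

Section finite_game.
Context (R : realType) (S A B : finType) (a0 : A) (b0 : B).
Context (q : B -> S * A -> S -> R) (r : S -> A -> S -> R).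
Hypothesis qP : forall b x, simplex R S (q b x).

Let Q (y : R) (u : S -> R) x b :=
  avg (q b x) (fun t => r x.1 x.2 t + y * u t).

(** A fixed point of the Shapley operator, maximum over actions of the minimum over moves. As the
    minimiser replies to the pair [(s, a)], the optimisers there form a saddle point without
    randomization. *)
Lemma discounted_game_solution (y : R) : 0 <= y < 1 ->
  exists (f : {ffun S -> A}) (tau : {ffun S * A -> B}) (v : S -> R),
  [/\ forall s, v s = Q y v (s, f s) (tau (s, f s)),
      forall s a, Q y v (s, a) (tau (s, a)) <= v s &
      forall s b, v s <= Q y v (s, f s) b].
Proof.
move=> /andP[y0 y1].
pose rb u x : B := [arg min_(b < b0) Q y u x b]%O.
pose W u x := Q y u x (rb u x).
have WP u x b : W u x <= Q y u x b.
  by rewrite /W /rb; case: arg_minP => // i _; exact.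
pose ra u s : A := [arg max_(a > a0) W u (s, a)]%O.
pose T u s := W u (s, ra u s).
have TP u s a : W u (s, a) <= T u s.
  by rewrite /T /ra; case: arg_maxP => // i _; exact.
have monoW u v : (forall s, u s <= v s) -> forall x, W u x <= W v x.
  move=> uv x; apply: le_trans (WP _ _ (rb v x)) _; apply: le_avg => // t.
  by rewrite lerD2l ler_wpM2l.
have [C C0 hC] := fin_norm_bound (fun z : S * A * S => r z.1.1 z.1.2 z.2).
(* The bound on discounted sums of rewards, which solves [C + y * c = c]; the constants [c] and
   [- c] are then a super- and a subsolution for [T]. *)
pose c := C / (1 - y); have y1' : 0 < 1 - y by rewrite subr_gt0.
have cE : C + y * c = c by rewrite /c; field; rewrite gt_eqF.
have c0 : 0 <= c by rewrite divr_ge0 // ltW.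
have [] := @monotone_fixpoint R S T c c0.
- move=> u v uv s; apply: le_trans (TP v s (ra u s)); exact: monoW.
- move=> s; apply: avg_le => // t.
  by have := hC (s, ra (fun=> c) s, t); rewrite ler_norml /= => /andP[]; lra.
- move=> s; rewrite -lerN2 opprK /T /W -avgN; apply: avg_le => // t.
  by have := hC (s, ra (fun=> - c) s, t); rewrite ler_norml /= => /andP[]; lra.
move=> v vE; exists (finfun (ra v)), (finfun (rb v)), v.
split=> [s|s a|s b]; rewrite ?ffunE; first exact: vE.
  by rewrite [leRHS]vE; exact: TP.
by rewrite [leLHS]vE; exact: WP.
Qed.

Lemma average_game_solution :
  exists (f : {ffun S -> A}) (tau : {ffun S * A -> B}) (g h : S -> R),
  [/\ forall s a, avg (q (tau (s, a)) (s, a)) g <= g s,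
      forall s a, avg (q (tau (s, a)) (s, a)) (fun t => r s a t + h t)
        <= g s + h s,
      forall s b, g s <= avg (q b (s, f s)) g &
      forall s b, g s + h s
        <= avg (q b (s, f s)) (fun t => r s (f s) t + h t)].
Proof.
have : forall n, exists z : {ffun S -> A} * {ffun S * A -> B} * (S -> R),
    let: (f, tau, v) := z in let y := 1 - n.+1%:R^-1 in
    [/\ forall s, v s = Q y v (s, f s) (tau (s, f s)),
        forall s a, Q y v (s, a) (tau (s, a)) <= v s &
        forall s b, v s <= Q y v (s, f s) b].
  move=> n; have [|f [tau [v hv]]] := @discounted_game_solution (1 - n.+1%:R^-1).
    by rewrite subr_ge0 gtrBl invr_gt0 ltr0n andbT invf_le1 // ler1n.
  by exists (f, tau, v).
move=> /choice[z hz].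
have [[f tau] hinf] := pigeonhole_infinite (fun n => (z n).1).
pose v n := (z n).2.
have {}hz N : exists2 n, (N <= n)%N & let y := 1 - n.+1%:R^-1 in
    [/\ forall s, v n s = Q y (v n) (s, f s) (tau (s, f s)),
        forall s a, Q y (v n) (s, a) (tau (s, a)) <= v n s &
        forall s b, v n s <= Q y (v n) (s, f s) b].
  have [n Nn zn] := hinf N; exists n => //; move: (hz n); rewrite /v.
  by case: (z n) zn => -[f' tau'] w /= [-> ->].
(* Along the indices where [(f, tau)] recurs, every [v n] is a discounted value of the same chain
   [p], so one choice of [g], [h] and [C] serves for all of them. *)
pose p s := q (tau (s, f s)) (s, f s).
have [g [h [C C0 hC]]] := @discounted_value_expansion R S p (fun=> qP _ _)
  (fun s => avg (p s) (r s (f s))).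
have {hC}hz N : exists2 n, (N <= n)%N &
    [/\ forall t, `|v n t - g t * n.+1%:R - h t| <= C / n.+1%:R,
        forall s a, Q (1 - n.+1%:R^-1) (v n) (s, a) (tau (s, a)) <= v n s &
        forall s b, v n s <= Q (1 - n.+1%:R^-1) (v n) (s, f s) b].
  have [n Nn [h1 h2 h3]] := hz N; exists n => //; split=> // t.
  rewrite -[in X in g t * X](invrK n.+1%:R); apply: hC => [|s].
    by rewrite invr_gt0 ltr0n invf_le1 // ler1n.
  by rewrite {1}h1 /Q avgD avgZ.
have up (x : S * A) : avg (q (tau x) x) g <= g x.1 /\
    (avg (q (tau x) x) g = g x.1 ->
     avg (q (tau x) x) (fun t => r x.1 x.2 t + h t) <= g x.1 + h x.1).
  apply: (discounted_inequality_limit C0 (qP _ _) (v := v)) => N.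
  have [n Nn [h1 h2 _]] := hz N; exists n => //; split=> //.
  by case: x => s a; exact: h2.
have lo (x : S * B) : g x.1 <= avg (q x.2 (x.1, f x.1)) g /\
    (g x.1 = avg (q x.2 (x.1, f x.1)) g ->
     g x.1 + h x.1 <=
     avg (q x.2 (x.1, f x.1)) (fun t => r x.1 (f x.1) t + h t)).
  (* The minimiser's side follows from the same lemma after a change of sign of [r], [g], [h] and
     [v]. *)
  have [|H1 H2] := @discounted_inequality_limit R S (q x.2 (x.1, f x.1))
    (fun t => - r x.1 (f x.1) t) (fun t => - g t) (fun t => - h t)
    (fun n t => - v n t) C x.1 C0 (qP _ _).
    move=> N; have [n Nn [h1 _ h3]] := hz N; exists n => //; split=> [t|].
      by rewrite !mulNr -!opprD normrN.
    rewrite -lerN2 opprK; apply: le_trans (h3 x.1 x.2) _.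
    rewrite -avgN le_eqVlt; apply/orP; left; apply/eqP; apply: eq_avg => t /=.
    by rewrite mulrN -opprD opprK.
  move: H1 H2; rewrite avgN lerN2 => H1 H2; split=> // e.
  have := H2 (congr1 -%R (esym e)).
  under eq_avg do rewrite -opprD.
  by rewrite avgN -opprD lerN2.
have [|K1 K10 hK1] := @uniform_multiplier R (S * A)%type
  (fun x => g x.1 - avg (q (tau x) x) g)
  (fun x => h x.1 - avg (q (tau x) x) (r x.1 x.2) + avg (q (tau x) x) g
            - avg (q (tau x) x) h).
  move=> x; have [h1 h2] := up x; rewrite subr_ge0; split=> // /eqP.
  by rewrite subr_eq0 => /eqP e; have := h2 (esym e); rewrite avgD; lra.
have [|K2 K20 hK2] := @uniform_multiplier R (S * B)%type
  (fun x => avg (q x.2 (x.1, f x.1)) g - g x.1)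
  (fun x => - (h x.1 - avg (q x.2 (x.1, f x.1)) (r x.1 (f x.1))
            + avg (q x.2 (x.1, f x.1)) g - avg (q x.2 (x.1, f x.1)) h)).
  move=> x; have [h1 h2] := lo x; rewrite subr_ge0; split=> // /eqP.
  by rewrite subr_eq0 => /eqP e; have := h2 (esym e); rewrite avgD; lra.
(* Adding a multiple of [g] to [h] brings the slack of the first-order inequalities into the
   second-order ones. The multiple is [K - 1] because the second-order gaps above contain the
   average of [g] instead of [g] itself. *)
pose K := Num.max K1 K2; exists f, tau, g, (fun t => h t + (K - 1) * g t).
split=> [s a|s a|s b|s b].
- exact: (up (s, a)).1.
- have := hK1 K _ (s, a); rewrite le_max lexx => /(_ isT).
  rewrite /= !avgD avgZ; lra.
- exact: (lo (s, b)).1.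
- have := hK2 K _ (s, b); rewrite le_max lexx orbT => /(_ isT).
  rewrite /= !avgD avgZ; lra.
Qed.

End finite_game.

(** * Expectations along trajectories *)

Section path_expectation.
Context (R : realType) (T : pointedFinType).
Implicit Types (w : nat -> T) (F G : (nat -> T) -> R) (n : nat).

Definition upd w n x : nat -> T := fun t => if t == n then x else w t.

Definition adapted (U : Type) n (F : (nat -> T) -> U) : Prop :=
  forall w w', (forall t, (t < n)%N -> w t = w' t) -> F w = F w'.

Lemma upd_lt w n x t : (t < n)%N -> upd w n x t = w t.
Proof. by move=> tn; rewrite /upd ltn_eqF. Qed.

Lemma upd_eq w n x : upd w n x n = x.
Proof. by rewrite /upd eqxx. Qed.

Lemma mkseq_adapted n : adapted n (fun w => mkseq w n).
Proof.
move=> w w' ww'; apply: (@eq_from_nth _ point); rewrite !size_mkseq // => i ni.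
by rewrite !nth_mkseq // ww'.
Qed.

Lemma adapted_upd (U : Type) n x (F : (nat -> T) -> U) w :
  adapted n F -> F (upd w n x) = F w.
Proof. by apply => t; exact: upd_lt. Qed.

Context (k : seq T -> T -> R).

(* [F] is evaluated on sequences equal to the junk value [point] from index
   [n] on. *)
Fixpoint pathE n F : R :=
  if n is m.+1 then pathE m (fun w => \sum_x k (mkseq w m) x * F (upd w m x))
  else F (fun=> point).

Lemma eq_pathE n F G : F =1 G -> pathE n F = pathE n G.
Proof. by move/funext ->. Qed.

Lemma pathED n F G : pathE n (fun w => F w + G w) = pathE n F + pathE n G.
Proof.
elim: n F G => //= n IH F G; rewrite -IH; apply: eq_pathE => w.
by rewrite -big_split; apply: eq_bigr => x _; rewrite mulrDr.
Qed.

Lemma pathEZ n c F : pathE n (fun w => c * F w) = c * pathE n F.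
Proof.
elim: n F => //= n IH F; rewrite -IH; apply: eq_pathE => w.
by rewrite mulr_sumr; apply: eq_bigr => x _; rewrite mulrCA.
Qed.

Lemma pathEN n F : pathE n (fun w => - F w) = - pathE n F.
Proof.
by rewrite -mulN1r -pathEZ; apply: eq_pathE => w; rewrite mulN1r.
Qed.

Lemma pathEB n F G : pathE n (fun w => F w - G w) = pathE n F - pathE n G.
Proof. by rewrite pathED pathEN. Qed.

Hypothesis kP : forall h, simplex R T (k h).

Lemma pathE_prefix n F : adapted n F -> pathE n.+1 F = pathE n F.
Proof.
move=> aF /=; apply: eq_pathE => w.
under eq_bigr do rewrite adapted_upd //.
by rewrite -mulr_suml (kP _).2 mul1r.
Qed.

Lemma pathE_cst n c : pathE n (fun=> c) = c.
Proof. by elim: n => //= n IH; rewrite -[RHS]IH; exact: pathE_prefix. Qed.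

(** Coordinates outside [ok] have weight zero. This serves for a stationary deterministic policy,
    whose inequalities hold only at the actions it chooses. *)
Lemma le_pathE_on (ok : pred T) n F G :
  (forall h x, ~~ ok x -> k h x = 0) ->
  (forall w, (forall t, (t < n)%N -> ok (w t)) -> F w <= G w) ->
  pathE n F <= pathE n G.
Proof.
move=> k0; elim: n F G => [|n IH] F G FG /=; first exact: FG.
apply: IH => w okw; apply: ler_sum => x _.
have [okx|/k0->] := boolP (ok x); last by rewrite !mul0r.
apply: ler_wpM2l; first exact: (kP _).1.
apply: FG => t; rewrite ltnS leq_eqVlt => /orP[/eqP->|tn].
  by rewrite upd_eq.
by rewrite upd_lt // okw.
Qed.

Lemma le_pathE n F G : (forall w, F w <= G w) -> pathE n F <= pathE n G.
Proof. by move=> FG; apply: (@le_pathE_on predT) => // w _. Qed.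

Lemma measurable_cylinder w n :
  measurable (cylinder w n : set (trajectory T)).
Proof. by apply: sub_sigma_algebra; exists w, n. Qed.

Lemma adapted_decomposition n F w : adapted n F ->
  F w = \sum_(u : n.-tuple T)
    F (nth point u) * \1_(cylinder (nth point u) n) w.
Proof.
move=> aF; rewrite (bigD1 [tuple of mkseq w n]) //= big1 ?addr0 => [|u uw].
  rewrite indicE mem_set ?mulr1; last by move=> t tn; rewrite nth_mkseq.
  by apply: aF => t tn; rewrite nth_mkseq.
rewrite indicE memNset ?mulr0 // => wu; move/eqP: uw; apply; apply: val_inj => /=.
apply: (@eq_from_nth _ point); rewrite size_tuple ?size_mkseq // => i ni.
by rewrite nth_mkseq // wu.
Qed.

(** Splitting a word into prefix and last letter matches the recursion of [pathE]. *)
Lemma adapted_decompositionS n F w : adapted n.+1 F ->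
  F w = \sum_(z : n.-tuple T * T) F (upd (nth point z.1) n z.2) *
    \1_(cylinder (upd (nth point z.1) n z.2) n.+1) w.
Proof.
move=> aF; rewrite -(pair_bigA _ (fun (u : n.-tuple T) (x : T) =>
  F (upd (nth point u) n x) * \1_(cylinder (upd (nth point u) n x) n.+1) w)) /=.
have -> : F w = F (upd w n (w n)).
  by apply: aF => t _; rewrite /upd; case: eqP => // ->.
rewrite (@adapted_decomposition n (fun w' => F (upd w' n (w n)))); last first.
  move=> v v' vv'; apply: aF => t; rewrite ltnS leq_eqVlt.
  by case/orP => [/eqP->|tn]; rewrite ?upd_eq // !upd_lt // vv'.
apply: eq_bigr => u _; rewrite (bigD1 (w n)) //= big1 ?addr0 => [|x xw].
  congr (_ * _); rewrite !indicE; congr ((nat_of_bool _)%:R).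
  apply/idP/idP; rewrite !inE /cylinder /= => h t tn.
    move: tn; rewrite ltnS leq_eqVlt => /orP[/eqP->|tn]; first by rewrite upd_eq.
    by rewrite upd_lt // h.
  by rewrite h ?upd_lt // ltnS ltnW.
rewrite indicE memNset ?mulr0 // => /(_ n (leqnn _)); rewrite upd_eq => e.
by rewrite e eqxx in xw.
Qed.

Lemma measurable_adapted n F : adapted n F ->
  measurable_fun setT (F : trajectory T -> R).
Proof.
move=> aF; rewrite (_ : F = fun w => \sum_(u : n.-tuple T)
    F (nth point u) * \1_(cylinder (nth point u) n) w); last first.
  by apply/funext => w; exact: adapted_decomposition.
apply: measurable_sum => u; apply: measurable_funM; first exact: measurable_cst.
by apply: measurable_indic; exact: measurable_cylinder.
Qed.

Lemma integral_finite_sum_indic d (X : measurableType d)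
    (mu : probability X R) (I : finType) (c : I -> R) (C : I -> set X) :
  (forall i, measurable (C i)) ->
  (\int[mu]_x (\sum_i c i * \1_(C i) x)%:E = \sum_i (c i)%:E * mu (C i))%E.
Proof.
move=> mC; under eq_integral do rewrite -sumEFin.
have iC i : mu.-integrable setT (fun x => (\1_(C i) x)%:E).
  by apply: integrable_indic => //; apply: le_lt_trans (ltry 1);
     exact: probability_le1.
rewrite integral_sum // => [|i].
  by apply: eq_bigr => i _; under eq_integral do rewrite EFinM;
     rewrite integralZl // integral_indic // setIT.
under eq_fun do rewrite EFinM; exact: integrableZl.
Qed.

(** Both sides reduce to weights of cylinders, and a cylinder of length [n.+1] weighs as much as its
    prefix times one value of [k]. *)
Lemma integral_adapted (mu : probability (trajectory T) R) n F :
  is_trajectory_law k mu -> adapted n F ->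
  (\int[mu]_w (F w)%:E = (pathE n F)%:E)%E.
Proof.
move=> muk; elim: n F => [|n IH] F aF.
  have -> : F = fun=> F (fun=> point) by apply/funext => w; exact: aF.
  have := @expectation_cst _ _ _ mu (F (fun=> point)).
  by rewrite unlock.
pose F' w := \sum_x k (mkseq w n) x * F (upd w n x).
have aF' : adapted n F'.
  move=> w w' ww'; apply: eq_bigr => x _; rewrite (mkseq_adapted ww').
  congr (_ * _); apply: aF => t; rewrite ltnS leq_eqVlt.
  by case/orP => [/eqP->|tn]; rewrite ?upd_eq // !upd_lt // ww'.
rewrite -[pathE n.+1 F]/(pathE n F') -IH //.
under eq_integral do rewrite (adapted_decompositionS _ aF).
under [RHS]eq_integral do rewrite (adapted_decomposition _ aF').
rewrite !integral_finite_sum_indic; try by move=> ?; exact: measurable_cylinder.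
rewrite -(pair_bigA _ (fun (u : n.-tuple T) (x : T) =>
  (F (upd (nth point u) n x))%:E *
  mu (cylinder (upd (nth point u) n x) n.+1)))%E /=.
apply: eq_bigr => u _.
have muE v m : mu (cylinder v m) = (\prod_(t < m) k (mkseq v t) (v t))%:E.
  exact: muk.
under eq_bigr do rewrite muE -EFinM.
rewrite muE -EFinM sumEFin; congr EFin; rewrite mulr_suml.
apply: eq_bigr => x _; rewrite big_ord_recr /= upd_eq.
rewrite (@adapted_upd _ n x (fun v => mkseq v n) _ (@mkseq_adapted n)).
rewrite mulrCA [RHS]mulrC [F _ * _]mulrC; congr (_ * _).
apply: eq_bigr => t _; rewrite upd_lt //; congr (k _ _).
by apply: mkseq_adapted => i it; rewrite upd_lt // (ltn_trans it).
Qed.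

End path_expectation.

(** * Limits superior of bounded sequences and their integrals *)

Section limsup.
Context (R : realType).
Implicit Types (u : nat -> R) (c C : R).

Lemma bounded_seq_fun u C : (forall n, `|u n| <= C) -> bounded_fun u.
Proof.
move=> uC; exists C; split; first exact: num_real.
by move=> M CM n _; apply: le_trans (uC n) (ltW CM).
Qed.

Lemma norm_seq_has_ubound u C : (forall n, `|u n| <= C) -> has_ubound (range u).
Proof. by move=> uC; exact/bounded_fun_has_ubound/(bounded_seq_fun uC). Qed.

Lemma norm_seq_has_lbound u C : (forall n, `|u n| <= C) -> has_lbound (range u).
Proof. by move=> uC; exact/bounded_fun_has_lbound/(bounded_seq_fun uC). Qed.

Lemma sups_ge u C n : (forall n, `|u n| <= C) -> u n <= sups u n.
Proof.
move=> uC; apply: ub_le_sup; last by exists n => /=.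
exact/has_ubound_sdrop/(norm_seq_has_ubound uC).
Qed.

Lemma sups_le u c n : (forall m, (n <= m)%N -> u m <= c) -> sups u n <= c.
Proof.
move=> uc; apply: ge_sup; first by exists (u n), n => /=.
by move=> _ [m /= nm <-]; exact: uc.
Qed.

Lemma norm_sups_le u C n : (forall n, `|u n| <= C) -> `|sups u n| <= C.
Proof.
move=> uC; rewrite ler_norml sups_le ?andbT => [|m _].
  apply: le_trans (sups_ge n uC).
  by have := uC n; rewrite ler_norml => /andP[].
by apply: le_trans (ler_norm _) (uC m).
Qed.

Lemma cvg_sups_limn_sup u C : (forall n, `|u n| <= C) ->
  sups u @ \oo --> limn_sup u.
Proof.
move=> uC; rewrite (limn_supE (bounded_seq_fun uC)).
by apply: cvg_sups_inf;
   [exact: norm_seq_has_ubound uC|exact: norm_seq_has_lbound uC].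
Qed.

Lemma norm_limn_sup_le u C : (forall n, `|u n| <= C) -> `|limn_sup u| <= C.
Proof.
move=> uC; have cu := cvg_sups_limn_sup uC; rewrite /limn_sup ler_norml.
have cvu : cvgn (sups u) by apply/cvg_ex; exists (limn_sup u).
by apply/andP; split; [apply: limr_ge|apply: limr_le] => //; apply: nearW => n;
   have := norm_sups_le n uC; rewrite ler_norml => /andP[].
Qed.

Lemma limn_sup_le u C c N : (forall n, `|u n| <= C) ->
  (forall n, (N <= n)%N -> u n <= c) -> limn_sup u <= c.
Proof.
move=> uC uc; have cu := cvg_sups_limn_sup uC.
apply: limr_le; first by apply/cvg_ex; exists (limn_sup u).
exists N => // n /= Nn; apply: sups_le => m nm; apply: uc.
exact: leq_trans nm.
Qed.

End limsup.

Section limsup_integral.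
Context d (X : measurableType d) (R : realType) (mu : probability X R).
Context (f : nat -> X -> R) (C : R).
Hypothesis mf : forall n, measurable_fun setT (f n).
Hypothesis fC : forall x n, `|f n x| <= C.

Lemma bounded_probability_integrable (h : X -> R) c :
  measurable_fun setT h -> (forall x, `|h x| <= c) ->
  mu.-integrable setT (EFin \o h).
Proof.
move=> mh hc; apply: measurable_bounded_integrable => //.
  by apply: le_lt_trans (ltry 1); exact: probability_le1.
exists c; split; first exact: num_real.
by move=> M cM x _; apply: le_trans (hc x) (ltW cM).
Qed.

Lemma measurable_limn_sup :
  measurable_fun setT (fun x => limn_sup (f ^~ x)).
Proof.
apply: measurable_fun_limn_sup => // x _.
  exact: norm_seq_has_ubound (fC x).
exact: norm_seq_has_lbound (fC x).
Qed.

Lemma integrable_limn_sup :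
  mu.-integrable setT (fun x => (limn_sup (f ^~ x))%:E).
Proof.
apply: (bounded_probability_integrable measurable_limn_sup) => x.
exact: norm_limn_sup_le (fC x).
Qed.

(** A form of the reverse Fatou lemma: [sups] dominates [f n] and converges to the limit superior,
    and the constant [C] permits dominated convergence. *)
Lemma limn_sup_integral_ge c N :
  (forall n, (N <= n)%N -> (c%:E <= \int[mu]_x (f n x)%:E)%E) ->
  (c%:E <= \int[mu]_x (limn_sup (f ^~ x))%:E)%E.
Proof.
move=> cf.
have ms n : measurable_fun setT (fun x => sups (f ^~ x) n).
  by apply: measurable_fun_sups => // x _; exact: norm_seq_has_ubound (fC x).
have [|||||_ _] := @dominated_convergence _ _ _ mu setT measurableT
  (fun n x => (sups (f ^~ x) n)%:E) (fun x => (limn_sup (f ^~ x))%:E)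
  (EFin \o cst C).
- by move=> n; exact/measurable_EFinP.
- exact/measurable_EFinP/measurable_limn_sup.
- apply: aeW => x _; apply: cvg_EFin; first exact: nearW.
  exact: cvg_sups_limn_sup (fC x).
- exact: finite_measure_integrable_cst.
- by apply: aeW => x n _; rewrite /= lee_fin; exact: norm_sups_le (fC x).
move=> cv; rewrite -(cvg_lim (@ereal_hausdorff R) cv).
apply: lime_ge; first by apply/cvg_ex; eexists; exact: cv.
exists N => // n /= Nn; apply: le_trans (cf n Nn) _.
apply: le_integral => //.
- exact: (bounded_probability_integrable (mf n) (fC ^~ n)).
- apply: (bounded_probability_integrable (ms n)) => x.
  exact: norm_sups_le (fC x).
- by move=> x _; rewrite lee_fin; exact: sups_ge (fC x).
Qed.

End limsup_integral.

(** Borel-Cantelli with a bounded potential [z]: the tail sums telescope to at most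
    [sup (range z) - z N], which is below [e] for a suitable [N]. *)
Lemma measure_tail_telescope d (X : measurableType d) (R : realType)
    (mu : probability X R) (B : nat -> set X) (z : nat -> R) (Z : R) :
  (forall n, measurable (B n)) ->
  (forall n, mu (B n) <= (z n.+1 - z n)%:E)%E -> (forall n, `|z n| <= Z) ->
  forall e, 0 < e -> exists N, (mu (\bigcup_(n in ~` `I_N) B n) <= e%:E)%E.
Proof.
move=> mB muB zZ e e0.
have incr N j : (\sum_(N <= n < N + j) mu (B n) <= (z (N + j)%N - z N)%:E)%E.
  elim: j => [|j IH]; first by rewrite addn0 big_geq // subrr.
  rewrite addnS big_nat_recr ?leq_addr //=; apply: le_trans (leeD IH (muB _)) _.
  by rewrite -EFinD lee_fin; lra.
have hs : has_sup (range z).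
  split; first by exists (z 0), 0%N.
  by exists Z => _ [n _ <-]; exact: le_trans (ler_norm _) (zZ n).
have [_ [N _ <-] hN] := sup_adherent e0 hs.
exists N.
apply: le_trans (@measure_sigma_subadditive_tail _ _ _ mu _ B N mB _ _) _ => //.
  exact: bigcup_measurable.
apply: lime_le; first exact: is_cvg_nneseries.
exists N => // m /= Nm; rewrite -(subnKC Nm); apply: le_trans (incr _ _) _.
rewrite lee_fin.
have : z (N + (m - N))%N <= sup (range z).
  by apply: ub_le_sup; [exact: hs.2|eexists].
lra.
Qed.

(** * Moment estimates for centred bounded increments *)

Section centered_moments.
Context (R : realType) (S : finType) (p d : S -> R) (C : R).
Hypotheses (pP : simplex R S p) (d0 : avg p d = 0) (dC : forall s, `|d s| <= C).

Let sqr_le s : d s ^+ 2 <= C ^+ 2.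
Proof.
rewrite -[d s ^+ 2]real_normK ?num_real // ler_sqr ?nnegrE //.
exact: le_trans (normr_ge0 _) (dC s).
Qed.

Lemma second_moment_step x : avg p (fun s => (x + d s) ^+ 2) <= x ^+ 2 + C ^+ 2.
Proof.
apply: (@le_trans _ _ (avg p (fun s => x ^+ 2 + C ^+ 2 + 2 * x * d s))).
  by apply: le_avg => // s; have := sqr_le s; rewrite !expr2; lra.
by rewrite avgD avgZ d0 mulr0 addr0 avg_cst.
Qed.

(** The term linear in [d s] averages to zero, and [4 * x * d s ^+ 3] is at most
    [2 * x ^+ 2 * d s ^+ 2 + 2 * d s ^+ 4]; hence the constants [8 = 6 + 2] and [3 = 1 + 2]. *)
Lemma fourth_moment_step x : avg p (fun s => (x + d s) ^+ 4) <=
  x ^+ 4 + 8 * C ^+ 2 * x ^+ 2 + 3 * C ^+ 4.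
Proof.
apply: (@le_trans _ _ (avg p (fun s =>
    (x ^+ 4 + 8 * C ^+ 2 * x ^+ 2 + 3 * C ^+ 4) + 4 * x ^+ 3 * d s))); last first.
  by rewrite avgD avgZ d0 mulr0 addr0 avg_cst.
apply: le_avg => // s.
set y := d s ^+ 2; have y0 : 0 <= y by exact: sqr_ge0.
have yC : y <= C ^+ 2 by exact: sqr_le.
have h1 : x ^+ 2 * y <= x ^+ 2 * C ^+ 2 by rewrite ler_wpM2l ?sqr_ge0.
have h2 : y ^+ 2 <= C ^+ 4.
  by rewrite (_ : 4 = 2 * 2)%N // exprM ler_sqr ?nnegrE ?sqr_ge0.
have h3 : 0 <= (x - d s) ^+ 2 * y by rewrite mulr_ge0 ?sqr_ge0.
rewrite -subr_ge0.
have -> : x ^+ 4 + 8 * C ^+ 2 * x ^+ 2 + 3 * C ^+ 4 + 4 * x ^+ 3 * d s -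
    (x + d s) ^+ 4 = 8 * (x ^+ 2 * C ^+ 2 - x ^+ 2 * y) + 3 * (C ^+ 4 - y ^+ 2) +
    2 * ((x - d s) ^+ 2 * y) by rewrite /y; ring.
by rewrite !addr_ge0 // mulr_ge0 // subr_ge0.
Qed.

End centered_moments.

(** * Martingales and excessive functions along the paths of a model *)

Section rmdp_paths.
Context (R : realType) (S A : pointedFinType).
Context (p0 : S -> R) (P : S * A -> S -> R) (pi : policy R S A).
Hypotheses (p0P : simplex R S p0) (PP : forall sa, simplex R S (P sa)).
Hypothesis piP : history_dependent pi.

Local Notation T := (S * A)%type.
Local Notation E := (pathE (next_pair p0 P pi)).

Let kP h : simplex R T (next_pair p0 P pi h).
Proof. exact: next_pair_simplex. Qed.

Lemma pathE_init (u : S -> R) : E 1 (fun w => u (w 0%N).1) = avg p0 u.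
Proof.
rewrite /= /avg -(pair_bigA _ (fun s a => next_pair p0 P pi [::] (s, a) *
  u (s, a).1)) /=.
apply: eq_bigr => s _; rewrite -mulr_suml; congr (_ * _).
by rewrite /next_pair /= -mulr_sumr (piP [::] s).2 mulr1.
Qed.

(** Whatever the policy, the action of the new pair sums out, and its state has law [P (w n)] given
    the past. This is the Markov step of the later inductions. *)
Lemma pathE_step n (F : (nat -> T) -> S -> R) :
  (forall s, adapted n.+1 (fun w => F w s)) ->
  E n.+2 (fun w => F w (w n.+1).1) = E n.+1 (fun w => avg (P (w n)) (F w)).
Proof.
move=> aF; rewrite -[LHS]/(E n.+1 (fun w => \sum_x
  next_pair p0 P pi (mkseq w n.+1) x *
  F (upd w n.+1 x) (upd w n.+1 x n.+1).1)).
apply: eq_pathE => w.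
under eq_bigr do rewrite upd_eq (adapted_upd _ _ (aF _)).
rewrite /avg -(pair_bigA _ (fun s a => next_pair p0 P pi (mkseq w n.+1) (s, a) *
  F w (s, a).1)) /=.
apply: eq_bigr => s _; rewrite -mulr_suml; congr (_ * _).
rewrite mkseqS /next_pair; case e : (rcons _ _) => [|y h].
  by move/(congr1 size): e; rewrite size_rcons.
have -> : last y h = w n by rewrite -[last y h]/(last y (y :: h)) -e last_rcons.
by rewrite /= -mulr_sumr (piP _ s).2 mulr1.
Qed.

Section martingale.
Context (u : T -> S -> R) (C : R).
Hypothesis uC : forall x s, `|u x s - avg (P x) (u x)| <= C.

Definition martingale (w : nat -> T) n : R :=
  \sum_(t < n) (u (w t) (w t.+1).1 - avg (P (w t)) (u (w t))).

Lemma martingale_adapted n : adapted n.+1 (martingale ^~ n).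
Proof.
move=> w w' ww'; apply: eq_bigr => t _.
by rewrite !ww' // !ltnS // ltnW.
Qed.

Lemma martingaleS w n : martingale w n.+1 =
  martingale w n + (u (w n) (w n.+1).1 - avg (P (w n)) (u (w n))).
Proof. by rewrite /martingale big_ord_recr. Qed.

Lemma pathE_martingale (phi : R -> R) n :
  E n.+2 (fun w => phi (martingale w n.+1)) =
  E n.+1 (fun w => avg (P (w n)) (fun s =>
    phi (martingale w n + (u (w n) s - avg (P (w n)) (u (w n)))))).
Proof.
rewrite -pathE_step => [|s w w' ww']; last first.
  by rewrite (martingale_adapted ww') !ww'.
by apply: eq_pathE => w; rewrite martingaleS.
Qed.

Let centered x : avg (P x) (fun s => u x s - avg (P x) (u x)) = 0.
Proof. by rewrite avgD avg_cst // subrr. Qed.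

Lemma martingale_second_moment n :
  E n.+1 (fun w => martingale w n ^+ 2) <= n%:R * C ^+ 2.
Proof.
elim: n => [|n IH].
  rewrite (eq_pathE _ _ (G := fun=> 0)) ?(pathE_cst kP) ?mul0r // => w.
  by rewrite /martingale big_ord0 expr0n.
rewrite (pathE_martingale (fun x => x ^+ 2)).
apply: (@le_trans _ _ (E n.+1 (fun w => martingale w n ^+ 2 + C ^+ 2))).
  by apply: (le_pathE kP) => w; exact: second_moment_step.
by rewrite pathED (pathE_cst kP) -natr1 mulrDl mul1r lerD2r.
Qed.

(** The second moment, linear in [n], drives the recursion, and [4 * n ^+ 2 + 8 * n + 3] is below
    [4 * n.+1 ^+ 2]. Quadratic growth makes the probabilities of deviations of linear size
    summable. *)
Lemma martingale_fourth_moment n :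
  E n.+1 (fun w => martingale w n ^+ 4) <= 4 * n%:R ^+ 2 * C ^+ 4.
Proof.
elim: n => [|n IH].
  rewrite (eq_pathE _ _ (G := fun=> 0)) ?(pathE_cst kP) ?expr0n ?mulr0 ?mul0r // => w.
  by rewrite /martingale big_ord0 expr0n.
rewrite (pathE_martingale (fun x => x ^+ 4)).
apply: (@le_trans _ _ (E n.+1 (fun w => martingale w n ^+ 4 +
    8 * C ^+ 2 * martingale w n ^+ 2 + 3 * C ^+ 4))).
  by apply: (le_pathE kP) => w; exact: fourth_moment_step.
rewrite !pathED pathEZ (pathE_cst kP).
have := ler_wpM2l (_ : 0 <= 8 * C ^+ 2) (martingale_second_moment n).
rewrite mulr_ge0 ?sqr_ge0 // => /(_ isT).
have : 0 <= C ^+ 4 by rewrite (_ : 4 = 2 * 2)%N // exprM sqr_ge0.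
have -> : 8 * C ^+ 2 * (n%:R * C ^+ 2) = 8 * n%:R * C ^+ 4 by ring.
have -> : 4 * n.+1%:R ^+ 2 * C ^+ 4 =
  4 * n%:R ^+ 2 * C ^+ 4 + 8 * n%:R * C ^+ 4 + 4 * C ^+ 4 by ring.
lra.
Qed.

End martingale.

Section excessive.
Context (g : S -> R) (G : R).
Hypotheses (gG : forall s, `|g s| <= G) (hg : forall x, avg (P x) g <= g x.1).

Lemma pathE_excessive n : E n.+1 (fun w => g (w n).1) <= avg p0 g.
Proof.
elim: n => [|n]; first by rewrite pathE_init.
by apply: le_trans; rewrite (pathE_step (F := fun=> g)) //; exact: (le_pathE kP).
Qed.

(* The squared increments of an excessive function telescope against [psi]. *)
Let psi s := g s ^+ 2 - 2 * G * g s.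

Lemma excessive_increment n :
  E n.+2 (fun w => (g (w n.+1).1 - g (w n).1) ^+ 2) <=
  E n.+2 (fun w => psi (w n.+1).1) - E n.+1 (fun w => psi (w n).1).
Proof.
rewrite (pathE_step (F := fun=> psi)) //.
rewrite (pathE_step (F := fun w s => (g s - g (w n).1) ^+ 2)); last first.
  by move=> s w w' ww'; rewrite ww'.
rewrite -pathEB; apply: (le_pathE kP) => w; set c := g (w n).1.
(* The term [- 2 * G * g s] in [psi] leaves the average of [g] with the nonnegative coefficient
   [2 * (G - c)], so that [hg] applies in the right direction. *)
have -> : avg (P (w n)) (fun s => (g s - c) ^+ 2) =
    avg (P (w n)) psi + 2 * (G - c) * avg (P (w n)) g + c ^+ 2.
  rewrite -{1}(avg_cst (c ^+ 2) (PP (w n))) -avgZ -!avgD.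
  by apply: eq_avg => s; rewrite /psi; ring.
have : 2 * (G - c) * avg (P (w n)) g <= 2 * (G - c) * c.
  apply: ler_wpM2l; last exact: hg.
  by rewrite mulr_ge0 // subr_ge0; exact: le_trans (ler_norm _) (gG _).
rewrite -[psi (w n).1]/(c ^+ 2 - 2 * G * c); lra.
Qed.

Lemma psi_bound s : `|psi s| <= 3 * G ^+ 2.
Proof.
apply: le_trans (ler_normB _ _) _.
have G0 : 0 <= G by apply: le_trans (gG s).
rewrite normrX !normrM normr_nat (ger0_norm G0).
have : `|g s| ^+ 2 <= G ^+ 2 by rewrite ler_sqr ?nnegrE.
have : G * `|g s| <= G * G by rewrite ler_wpM2l.
by rewrite !expr2; lra.
Qed.

Lemma pathE_psi_bound n : `|E n.+1 (fun w => psi (w n).1)| <= 3 * G ^+ 2.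
Proof.
have h s : - (3 * G ^+ 2) <= psi s <= 3 * G ^+ 2 by rewrite -ler_norml psi_bound.
rewrite ler_norml; apply/andP; split.
  rewrite -(pathE_cst kP n.+1 (- _)); apply: (le_pathE kP) => w.
  by case/andP: (h (w n).1).
rewrite -[leRHS](pathE_cst kP n.+1); apply: (le_pathE kP) => w.
by case/andP: (h (w n).1).
Qed.

End excessive.

End rmdp_paths.

(** * Bounds on the average return *)

Section average_return_bounds.
Context (R : realType) (S A : pointedFinType) (M : rmdp R S A).
Context (P : S * A -> S -> R) (pi : policy R S A).
Hypotheses (UP : uncertainty M P) (piP : history_dependent pi).
Context (g h : S -> R).

Local Notation T := (S * A)%type.
Local Notation k := (next_pair (init M) P pi).
Local Notation E := (pathE k).
Local Notation r := (reward M).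

Let PP sa : simplex R S (P sa).
Proof. exact: uncertainty_simplex UP sa. Qed.

Let kP x : simplex R T (k x).
Proof. exact: next_pair_simplex (init_simplex M) PP piP x. Qed.

Let lawP : is_trajectory_law k (law M pi P).
Proof. exact: (trajectory_lawP kP). Qed.

Lemma mean_reward_adapted n : adapted n.+2 (fun w : nat -> T => mean_reward M w n).
Proof.
move=> w w' ww'; congr (_ * _); apply: eq_bigr => t _.
by rewrite !ww' // ltnS ?ltn_ord // ltnW.
Qed.

Lemma mean_reward_bounded : exists2 C, 0 <= C &
  forall (w : nat -> T) n, `|mean_reward M w n| <= C.
Proof.
have [C C0 hC] := fin_norm_bound (fun z : S * A * S => r z.1.1 z.1.2 z.2).
exists C => // w n; rewrite normrM ger0_norm ?invr_ge0 // mulrC ler_pdivrMr //.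
apply: le_trans (ler_norm_sum _ _ _) _.
apply: (@le_trans _ _ (\sum_(t < n.+1) C)).
  by apply: ler_sum => t _; exact: (hC (w t, (w t.+1).1)).
by rewrite sumr_const card_ord mulr_natr.
Qed.

Section upper.
Hypotheses (hg : forall x, avg (P x) g <= g x.1)
  (hh : forall x, avg (P x) (fun s => r x.1 x.2 s + h s) <= g x.1 + h x.1).

Let u (x : T) s := r x.1 x.2 s + h s.

(** By [hh] each reward is at most a martingale increment plus [g] at the current state plus a
    difference of [h], which telescopes. *)
Let sum_reward_le (w : nat -> T) n :
  \sum_(t < n) r (w t).1 (w t).2 (w t.+1).1 <=
  martingale P u w n + \sum_(t < n) g (w t).1 + h (w 0%N).1 - h (w n).1.
Proof.
elim: n => [|n IH]; first by rewrite /martingale !big_ord0; lra.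
rewrite martingaleS !big_ord_recr /= {2}/u.
by have := hh (w n); rewrite -/u; lra.
Qed.

Let bad e n (w : nat -> T) :=
  (g (w n.+1).1 != g (w n).1) || (e * n.+1%:R < `|martingale P u w n.+1|).

Let bad_adapted e n : adapted n.+2 (bad e n).
Proof.
by move=> w w' ww'; rewrite /bad (martingale_adapted _ _ ww') !ww'.
Qed.

(** From time [N] on [g] keeps the value [g (w N).1]. Each earlier term misses it by at most
    [2 * G], the boundary values of [h] cost [2 * H], and the martingale costs [e] per step. *)
Let mean_reward_le e N (w : nat -> T) G H n : 0 < e ->
  (forall s, `|g s| <= G) -> (forall s, `|h s| <= H) ->
  (forall m, (N <= m)%N -> ~~ bad e m w) -> (N <= n)%N ->
  mean_reward M w n <= g (w N).1 + e + (2 * G * N%:R + 2 * H) / n.+1%:R.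
Proof.
move=> e0 gG hH good Nn.
have G0 : 0 <= G by apply: le_trans (gG point).
have gN m : (N <= m)%N -> g (w m).1 = g (w N).1.
  move=> Nm; rewrite -(subnKC Nm); elim: (m - N)%N => [|j IH]; first by rewrite addn0.
  have := good (N + j)%N (leq_addr _ _).
  by rewrite negb_or negbK addnS => /andP[/eqP->].
have sg m : \sum_(t < m) g (w t).1 <= m%:R * g (w N).1 + 2 * G * (minn m N)%:R.
  elim: m => [|m IH]; first by rewrite big_ord0 min0n mul0r mulr0 addr0.
  rewrite big_ord_recr /=; have [Nm|mN] := leqP N m.
    rewrite (minn_idPr (leqW Nm)) gN // -natr1.
    by move: IH; rewrite (minn_idPr Nm); lra.
  rewrite (minn_idPl mN) -!natr1; move: IH; rewrite (minn_idPl (ltnW mN)).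
  have := gG (w m).1; have := gG (w N).1; rewrite !ler_norml.
  move=> /andP[? _] /andP[_ ?]; lra.
rewrite /mean_reward mulrC ler_pdivrMr // mulrDl divfK ?pnatr_eq0 //.
apply: le_trans (sum_reward_le w n.+1) _.
have := good n Nn; rewrite negb_or -leNgt => /andP[_].
move=> /(le_trans (ler_norm _)).
have := sg n.+1; rewrite (minn_idPr (leqW Nn)).
have := hH (w 0%N).1; have := hH (w n.+1).1; rewrite !ler_norml.
move=> /andP[? _] /andP[_ ?]; lra.
Qed.

(** Markov's inequality, with squares for the jumps of [g] and fourth powers for the martingale.
    Both bounds telescope, which gives the potential [z] for [measure_tail_telescope]. *)
Let bad_probability e : 0 < e -> exists z Z, (forall n, `|z n| <= Z) /\
  forall n, E n.+2 (fun w => (bad e n w)%:R) <= z n.+1 - z n.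
Proof.
move=> e0; have [G G0 gG] := fin_norm_bound g.
have [C C0 uC] := fin_norm_bound (fun z : T * S => u z.1 z.2 - avg (P z.1) (u z.1)).
(* As [g] has finitely many values, its nonzero jumps stay away from zero and [K] bounds their
   inverse squares; equal values contribute [0^-1 = 0]. *)
have [K K0 hK] := fin_norm_bound (fun z : S * S => ((g z.1 - g z.2) ^+ 2)^-1).
pose ps s := g s ^+ 2 - 2 * G * g s.
(* Twice the constant [4 * C ^+ 4 / e ^+ 4], to pay for [1 / m ^+ 2 <= 2 * (1 / m - 1 / m.+1)] at
   [m = n.+1]. *)
pose L := 8 * C ^+ 4 / e ^+ 4.
have L0 : 0 <= L by rewrite divr_ge0 ?mulr_ge0 ?exprn_ge0 // ltW.
pose z n := K * E n.+1 (fun w => ps (w n).1) - L / n.+1%:R.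
exists z, (K * (3 * G ^+ 2) + L); split=> n.
  apply: le_trans (ler_normB _ _) _; apply: lerD.
    rewrite normrM (ger0_norm K0) ler_wpM2l //.
    exact: (pathE_psi_bound (init_simplex M) PP piP gG).
  by rewrite ger0_norm ?(divr_ge0 L0) // ler_pdivrMr // ler_peMr // ler1n.
have en0 : 0 < e * n.+1%:R by rewrite mulr_gt0.
apply: (@le_trans _ _ (E n.+2 (fun w =>
    K * (g (w n.+1).1 - g (w n).1) ^+ 2 +
    (e * n.+1%:R)^-1 ^+ 4 * martingale P u w n.+1 ^+ 4))).
  apply: (le_pathE kP) => w; rewrite /bad.
  set a := g _; set b := g (w n).1; set m := martingale _ _ _ _.
  have ab0 : 0 <= K * (a - b) ^+ 2 by rewrite mulr_ge0 ?sqr_ge0.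
  have -> : (e * n.+1%:R)^-1 ^+ 4 * m ^+ 4 = ((`|m| / (e * n.+1%:R)) ^+ 2) ^+ 2.
    by rewrite -exprM exprMn mulrC -[in RHS]normrX ger0_norm // exprn_even_ge0.
  have [ab|ab] := eqVneq a b => /=; last first.
    rewrite -[1%:R]addr0 lerD ?sqr_ge0 //.
    have ab2 : 0 < (a - b) ^+ 2 by rewrite exprn_even_gt0 // subr_eq0.
    rewrite -ler_pdivrMr // mul1r.
    by apply: le_trans (hK ((w n.+1).1, (w n).1)); exact: ler_norm.
  case: ltP => [em|_]; last by rewrite addr_ge0 ?sqr_ge0.
  rewrite -[1%:R]add0r lerD // !exprn_ege1 // ler_pdivlMr // mul1r; exact: ltW.
rewrite pathED !pathEZ.
have h1 := excessive_increment (init_simplex M) PP piP gG hg n.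
have h2 := martingale_fourth_moment (init_simplex M) PP piP
  (fun x s => uC (x, s)) n.+1.
have h3 : (e * n.+1%:R)^-1 ^+ 4 * E n.+2 (fun w => martingale P u w n.+1 ^+ 4) <=
    L / n.+1%:R - L / n.+2%:R.
  apply: le_trans (ler_wpM2l _ h2) _; first by rewrite exprn_ge0 // invr_ge0 ltW.
  have y0 m : m.+1%:R != 0 :> R by rewrite pnatr_eq0.
  have -> : (e * n.+1%:R)^-1 ^+ 4 * (4 * n.+1%:R ^+ 2 * C ^+ 4) =
      L / 2 / n.+1%:R ^+ 2.
    by move: (y0 n); rewrite /L; move: n.+1%:R => y yn0; field; rewrite yn0 gt_eqF.
  have -> : L / n.+1%:R - L / n.+2%:R = L / (n.+1%:R * n.+2%:R).
    rewrite -[n.+2%:R]natr1; move: (y0 n) (y0 n.+1); rewrite -[n.+2%:R]natr1.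
    by move: n.+1%:R => y yn0 yn1; field; rewrite yn0 yn1.
  rewrite -mulrA ler_wpM2l // -invfM lef_pV2 ?posrE ?mulr_gt0 //.
  rewrite expr2 -natrM -natrM -natrM ler_nat mulnCA leq_mul2l /=.
  by rewrite mul2n -addnn addSnnS leq_addl.
have := ler_wpM2l K0 h1; rewrite mulrBr; move: h3; rewrite /z /ps.
set a1 := L / n.+1%:R; set a2 := L / n.+2%:R.
move=> h3 {}h1; apply: le_trans (lerD h1 h3) _; lra.
Qed.

Lemma Ravg_le : (Ravg M pi P <= (avg (init M) g)%:E)%E.
Proof.
have [C C0 hC] := mean_reward_bounded.
have [G G0 gG] := fin_norm_bound g.
have [H H0 hH] := fin_norm_bound h.
pose f n (w : trajectory T) := mean_reward M w n.
have mf n : measurable_fun setT (f n).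
  exact: measurable_adapted (@mean_reward_adapted n).
have step e : 0 < e ->
    (Ravg M pi P <= (avg (init M) g + 2 * e + (C + G) * e)%:E)%E.
  move=> e0; have [z [Z [zZ hz]]] := bad_probability e0.
  pose B n : set (trajectory T) := [set w | bad e n w].
  have indB n : \1_(B n) = (fun w => (bad e n w)%:R) :> (trajectory T -> R).
    apply/funext => w; rewrite indicE /B; congr ((nat_of_bool _)%:R).
    by apply/idP/idP; rewrite inE.
  have aB n : adapted n.+2 (fun w : nat -> T => (bad e n w)%:R : R).
    by move=> w w' ww'; rewrite (bad_adapted _ ww').
  have mB n : measurable (B n).
    apply/(@measurable_indicP _ _ R); rewrite indB.
    exact: measurable_adapted (aB n).
  have muB n : (law M pi P (B n) <= (z n.+1 - z n)%:E)%E.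
    have <- : (\int[law M pi P]_w (\1_(B n) w)%:E = law M pi P (B n))%E.
      by rewrite integral_indic // setIT.
    by rewrite indB (integral_adapted lawP (aB n)) lee_fin.
  have [N hN] := measure_tail_telescope mB muB zZ e0.
  set BN := bigcup _ _ in hN.
  have mBN : measurable BN by exact: bigcup_measurable.
  have CG0 : 0 <= C + G by rewrite addr_ge0.
  have aN : adapted N.+1 (fun w : nat -> T => g (w N).1 + 2 * e).
    by move=> w w' ww'; rewrite ww'.
  (* Off [BN] one [e] covers the martingale and the other the term of order [1 / n] in
     [mean_reward_le]; on [BN] the crude bound [C + G] suffices. *)
  have bound w : limn_sup (f ^~ w) <= (g (w N).1 + 2 * e) + (C + G) * \1_BN w.
    rewrite indicE; have [wB|wB] := pselect (BN w).
      rewrite mem_set // mulr1.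
      have := norm_limn_sup_le (hC w); have := gG (w N).1; rewrite !ler_norml.
      by move=> /andP[? _] /andP[_ ?]; rewrite /f; lra.
    rewrite memNset // mulr0 addr0.
    have good m : (N <= m)%N -> ~~ bad e m w.
      move=> Nm; apply/negP => bw; apply: wB; exists m => //=.
      by apply/negP; rewrite -leqNgt.
    have c0 : 0 <= 2 * G * N%:R + 2 * H by rewrite addr_ge0 ?mulr_ge0.
    pose N' := maxn N (Num.bound ((2 * G * N%:R + 2 * H) / e)).
    apply: (limn_sup_le (N := N') (hC w)) => n; rewrite geq_max => /andP[Nn bn].
    apply: le_trans (mean_reward_le e0 gG hH good Nn) _.
    have -> : g (w N).1 + 2 * e = g (w N).1 + e + e by lra.
    rewrite lerD2l ler_pdivrMr // [e * _]mulrC -ler_pdivrMr //.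
    apply: le_trans (ltW (archi_boundP _)) _; first by rewrite divr_ge0 // ltW.
    by rewrite ler_nat (leq_trans bn).
  have iN : (law M pi P).-integrable setT (fun w => (g (w N).1 + 2 * e)%:E).
    apply: (bounded_probability_integrable _ (c := G + 2 * e)).
      exact: measurable_adapted aN.
    move=> w; apply: le_trans (ler_normD _ _) _.
    by rewrite lerD // ger0_norm // mulr_ge0 // ltW.
  have iB : (law M pi P).-integrable setT (fun w => (\1_BN w)%:E).
    by apply: integrable_indic => //; apply: le_lt_trans (ltry 1).
  rewrite /Ravg unlock.
  apply: (@le_trans _ _ (\int[law M pi P]_w ((g (w N).1 + 2 * e)%:E +
      (C + G)%:E * (\1_BN w)%:E))%E).
    apply: le_integral => //.
    - exact: (integrable_limn_sup _ mf hC).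
    - by apply: integrableD => //; exact: integrableZl.
    - by move=> w _; rewrite -EFinM -EFinD lee_fin bound.
  rewrite integralD //; last exact: integrableZl.
  rewrite integralZl // integral_indic // setIT (integral_adapted lawP aN).
  rewrite pathED (pathE_cst kP) [leRHS]EFinD; apply: leeD.
    by rewrite lee_fin lerD2r; exact: (pathE_excessive (init_simplex M) PP piP hg).
  by rewrite EFinM lee_wpmul2l ?lee_fin.
apply/lee_addgt0Pr => e e0; pose c := 2 + C + G.
have c0 : 0 < c by rewrite /c; lra.
apply: le_trans (step (e / c) (divr_gt0 e0 c0)) _.
rewrite -EFinD lee_fin -addrA lerD2l le_eqVlt; apply/orP; left.
by apply/eqP; rewrite /c; field; rewrite gt_eqF.
Qed.

End upper.
End average_return_bounds.

(** * Lower bound on the return of a stationary deterministic policy *)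

Section stationary_lower_bound.
Context (R : realType) (S A : pointedFinType) (M : rmdp R S A).
Context (P : S * A -> S -> R) (f : S -> A).
Hypothesis UP : uncertainty M P.
Context (g h : S -> R).
Hypotheses (hg : forall s, g s <= avg (P (s, f s)) g)
  (hh : forall s, g s + h s <=
    avg (P (s, f s)) (fun t => reward M s (f s) t + h t)).

Local Notation T := (S * A)%type.
Local Notation pi := (stationary_deterministic R f).
Local Notation k := (next_pair (init M) P pi).
Local Notation E := (pathE k).
Local Notation r := (reward M).

Let PP sa : simplex R S (P sa).
Proof. exact: uncertainty_simplex UP sa. Qed.

Let piP : history_dependent pi.
Proof. exact: stationary_deterministic_history_dependent. Qed.

Let kP x : simplex R T (k x).
Proof. exact: next_pair_simplex (init_simplex M) PP piP x. Qed.

Let follows (x : T) := x.2 == f x.1.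

Let follows_support y (x : T) : ~~ follows x -> k y x = 0.
Proof.
by rewrite /follows /next_pair /stationary_deterministic => /negPf ->; rewrite mulr0.
Qed.

Let follows_eq (x : T) : follows x -> x = (x.1, f x.1).
Proof. by case: x => s a /eqP /= ->. Qed.

Lemma pathE_defective n : avg (init M) g <= E n.+1 (fun w => g (w n).1).
Proof.
elim: n => [|n IH]; first by rewrite (pathE_init _ _ piP).
apply: le_trans IH _; rewrite (pathE_step _ _ piP (F := fun=> g)) //.
apply: (le_pathE_on kP follows_support) => w /(_ n (leqnn _)) /follows_eq ->.
exact: hg.
Qed.

Let total (w : nat -> T) n := \sum_(t < n) r (w t).1 (w t).2 (w t.+1).1.

Let total_adapted n : adapted n.+1 (total ^~ n).
Proof.
move=> w w' ww'; apply: eq_bigr => t _.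
by rewrite !ww' // !ltnS // ltnW.
Qed.

(** At each step [total] plus [h] grows in mean by at least the mean of [g], which [pathE_defective]
    bounds from below. *)
Let total_ge n : n%:R * avg (init M) g + avg (init M) h <=
  E n.+1 (fun w => total w n + h (w n).1).
Proof.
elim: n => [|n IH].
  rewrite (eq_pathE _ _ (G := fun w => h (w 0%N).1)) => [|w].
    by rewrite (pathE_init _ _ piP) mul0r add0r.
  by rewrite /total big_ord0 add0r.
rewrite (eq_pathE _ _ (G := fun w => total w n +
    (r (w n).1 (w n).2 (w n.+1).1 + h (w n.+1).1))); last first.
  by move=> w; rewrite /total big_ord_recr /= addrA.
rewrite (pathE_step _ _ piP
  (F := fun w s => total w n + (r (w n).1 (w n).2 s + h s))); last first.
  by move=> s w w' ww'; rewrite (total_adapted ww') !ww'.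
apply: (@le_trans _ _ (E n.+1 (fun w => (total w n + h (w n).1) + g (w n).1))).
  rewrite pathED -natr1; have := pathE_defective n; lra.
apply: (le_pathE_on kP follows_support) => w /(_ n (leqnn _)) /follows_eq.
move: (w n) => x ->; rewrite avgD avg_cst //=.
by have := hh x.1; lra.
Qed.

Lemma Ravg_ge : ((avg (init M) g)%:E <= Ravg M pi P)%E.
Proof.
have [C C0 hC] := mean_reward_bounded M.
have [H H0 hH] := fin_norm_bound h.
have lawP : is_trajectory_law k (law M pi P) by exact: (trajectory_lawP kP).
apply/lee_addgt0Pr => e e0; rewrite -leeBlDr // -EFinB /Ravg unlock.
pose F n (w : trajectory T) := mean_reward M w n.
have mF n : measurable_fun setT (F n).
  exact: measurable_adapted (@mean_reward_adapted _ _ _ M n).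
(* The expected mean reward falls short of [avg (init M) g] by at most [2 * H / n.+1%:R], which is
   at most [e] from this index on. *)
apply: (limn_sup_integral_ge mF hC (N := Num.bound (2 * H / e))) => n Nn.
rewrite (integral_adapted lawP (@mean_reward_adapted _ _ _ M n)) lee_fin.
rewrite /mean_reward pathEZ -/(total _ _) mulrC ler_pdivlMr //.
have hp : - H <= avg (init M) h.
  have := norm_avg_le (init_simplex M) hH; by rewrite ler_norml => /andP[].
have : n.+1%:R * avg (init M) g - 2 * H <= E n.+2 (fun w => total w n.+1).
  have : E n.+2 (fun w => total w n.+1 + h (w n.+1).1) <=
      E n.+2 (fun w => total w n.+1) + H.
    rewrite -{1}(pathE_cst kP n.+2 H) -pathED; apply: (le_pathE kP) => w.
    by rewrite lerD2l; exact: le_trans (ler_norm _) (hH _).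
  have := total_ge n.+1; lra.
suff : 2 * H <= e * n.+1%:R by lra.
rewrite [e * _]mulrC -ler_pdivrMr //.
apply: le_trans (ltW (archi_boundP _)) _; first by rewrite divr_ge0 ?mulr_ge0 // ltW.
by rewrite ler_nat (leq_trans Nn).
Qed.

End stationary_lower_bound.

(** * Reduction of the robust problem to a finite game *)

Lemma stationary_deterministic_optimal (R : realType) (S A : pointedFinType)
    (M : rmdp R S A) : sa_rectangular (uncertainty M) ->
  exists f : {ffun S -> A},
    (optimal_Ravg M <= worst_Ravg M (stationary_deterministic R f))%E.
Proof.
move=> [Usa _ UE]; apply: contrapT => no.
have beat (f : {ffun S -> A}) : exists P, uncertainty M P /\
    (Ravg M (stationary_deterministic R f) P < optimal_Ravg M)%E.
  have : (worst_Ravg M (stationary_deterministic R f) < optimal_Ravg M)%E.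
    by rewrite ltNge; apply/negP => h; apply: no; exists f.
  by move=> /ereal_inf_lt[_ [P UP <-] ?]; exists P.
(* The minimiser's moves are indexed by the policies: move [f] plays the kernel of the model [Q f]
   that defeats policy [f]. *)
have [Q hQ] := choice beat.
have QE f x : Usa x (Q f x) by have := (hQ f).1; rewrite UE; exact.
have [f [tau [g [h [up1 up2 lo1 lo2]]]]] :=
  @average_game_solution R S A {ffun S -> A} point (finfun (fun=> point))
    Q (reward M) (fun b => uncertainty_simplex (hQ b).1).
pose Ptau x := Q (tau x) x.
(* Rectangularity makes this mixture of the [Q f] a model. *)
have UPtau : uncertainty M Ptau by rewrite UE => x; exact: QE.
have := (hQ f).2; rewrite ltNge => /negP; apply.
(* Playing move [f] at every pair reproduces the model [Q f], hence the instances at [f] of [lo1]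
   and [lo2]. *)
apply: le_trans (Ravg_ge (hQ f).1 (fun s => lo1 s f) (fun s => lo2 s f)).
apply: ge_ereal_sup => _ [pi piP <-].
apply: (@le_trans _ _ (Ravg M pi Ptau)).
  by apply: ereal_inf_lbound; exists Ptau.
by apply: (Ravg_le UPtau piP (h := h)) => -[s a]; [exact: up1|exact: up2].
Qed.

Local Open Scope ereal_scope.

Theorem theorem3p4 (R : realType) (S A : pointedFinType) (M : rmdp R S A)
    (hU : sa_rectangular (uncertainty M)) :
  (exists f : S -> A, average_optimal M (stationary_deterministic R f)) /\
  ereal_sup [set worst_Ravg M pi | pi in @history_dependent R S A] =
    \big[maxe/-oo]_(f : {ffun S -> A})
      worst_Ravg M (stationary_deterministic R f).
Proof.
have worst_le (f : S -> A) :
    worst_Ravg M (stationary_deterministic R f) <= optimal_Ravg M.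
  apply: ereal_sup_ubound; exists (stationary_deterministic R f) => //.
  exact: stationary_deterministic_history_dependent.
have [f hf] := stationary_deterministic_optimal hU.
split.
  exists f; split; first exact: stationary_deterministic_history_dependent.
  by apply/le_anti; rewrite worst_le.
apply/le_anti/andP; split; first by apply: le_trans hf _; exact: le_bigmax.
by apply: bigmax_le; [exact: leNye|move=> f' _; exact: worst_le].
Qed.
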